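(* Let $p$ be an odd prime. There is a unique $p$-core $p'$-partition of maximal size, and it corresponds (under the correspondence described in the context) to the unique walk of maximal length on the additive residue graph $\mathcal{G}_p$.
   Context: A partition is $p$-core if none of its hook lengths is divisible by $p$, and is a $p'$-partition if none of its parts is divisible by $p$. Abacus: the $p$-abacus has runners $0,\dots,p-1$; position $n\ge 0$ lies on runner $n \bmod p$ in row $\lfloor n/p\rfloor+1$, and positions are ordered by $n$. A partition $\lambda=(\lambda_1\ge\dots\ge\lambda_\ell>0)$ is represented by beads at positions $\lambda_k+\ell-k$ ($1\le k\le \ell$), all other positions being gaps; so position $0$ is a gap and each bead contributes a part equal to the number of gaps at smaller positions. $\lambda$ is $p$-core iff on each runner the beads occupy the topmost positions of that runner. For a $p$-core $\lambda$ whose beads are rightmost within their rows (in each row the beads occupy the rightmost positions of the row), the $i$-th row multiplicity $m_i$ ($1\le i\le p-1$) is the number of rows containing exactly $i$ gaps and $p-i$ beads; all beads in one row contribute parts of the same size, and the abacus residue sequence is the sequence (from top to bottom over rows containing beads) of these common sizes reduced modulo $p$. Graph: the additive residue graph $\mathcal{G}_p$ is the directed labelled graph with vertex set $\mathbb{Z}/p\mathbb{Z}$ and, for each vertex $r$ and each $1\le i\le p-1$, an edge labelled $i$ (an $i$-edge) from $r$ to $r+i$. A walk on $\mathcal{G}_p$ means a finite walk starting at vertex $0$ whose edge labels are weakly increasing along the walk and which never returns to vertex $0$; its length is its number of edges. Correspondence: a $p$-core $p'$-partition whose beads are rightmost within their rows corresponds to the walk traversing, in increasing order of label, exactly $m_i$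 edges labelled $i$ for each $i$; the sequence of vertices visited after the initial $0$ equals the abacus residue sequence. This is a bijection between $p$-core $p'$-partitions with beads rightmost within their rows and walks on $\mathcal{G}_p$. *)

(* Defs.v *)
From mathcomp Require Import all_boot all_order all_algebra.
Import GRing.Theory.
Local Open Scope nat_scope.

(* Partitions: weakly decreasing sequences of positive parts; |la| is sumn la. *)
Definition is_partition (la : seq nat) : bool := sorted geq la && (0 \notin la).

(* The 0-based cell (i, j) has arm la_i - (j+1) and leg la'_j - (i+1), where
   la'_j counts the parts exceeding j; the hook length is arm + leg + 1. *)
Definition hook (la : seq nat) (i j : nat) : nat :=
  (nth 0 la i - j.+1) + (count (fun x => j < x) la - i.+1) + 1.

Definition hooks (la : seq nat) : seq nat :=
  [seq hook la i j | i <- iota 0 (size la), j <- iota 0 (nth 0 la i)].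

Definition p_core (p : nat) (la : seq nat) : bool :=
  all (fun h => ~~ (p %| h)) (hooks la).

Definition p'_parts (p : nat) (la : seq nat) : bool :=
  all (fun x => ~~ (p %| x)) la.

Definition core_p'_partition (p : nat) (la : seq nat) : bool :=
  [&& is_partition la, p_core p la & p'_parts p la].

(* With 0-based k, the bead of part la_k is at la_k + (size la - (k+1)). *)
Definition beads (la : seq nat) : seq nat :=
  mkseq (fun k => nth 0 la k + (size la - k.+1)) (size la).

(* Rows are numbered from 0, so row r consists of positions rp, ..., rp+p-1. *)
Definition row (p r : nat) : seq nat := iota (r * p) p.

Definition row_beads (p : nat) (la : seq nat) (r : nat) : seq nat :=
  [seq n <- row p r | n \in beads la].

Definition row_gaps (p : nat) (la : seq nat) (r : nat) : nat :=
  count (fun n => n \notin beads la) (row p r).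

Definition beads_rightmost (p : nat) (la : seq nat) : Prop :=
  forall r m n, m \in row p r -> n \in row p r -> m < n ->
    m \in beads la -> n \in beads la.

(* All rows from this one on are bead-free, so rows with fewer than p gaps
   have a smaller index. *)
Definition row_bound (p : nat) (la : seq nat) : nat :=
  ((\max_(n <- beads la) n) %/ p).+1.

(* Only meaningful for 1 <= i <= p-1. *)
Definition row_mult (p : nat) (la : seq nat) (i : nat) : nat :=
  count (fun r => row_gaps p la r == i) (iota 0 (row_bound p la)).

Definition bead_part (la : seq nat) (n : nat) : nat :=
  count (fun m => m \notin beads la) (iota 0 n).

(* The part size of a row is read off its first bead; when the beads are
   rightmost within their rows, all beads of the row give the same size. *)
Definition residue_seq (p : nat) (la : seq nat) : seq 'Z_p :=
  [seq (bead_part la (head 0 (row_beads p la r)))%:R%R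
     | r <- iota 0 (row_bound p la) & row_beads p la r != [::]].

Definition residue_edge (p : nat) (r : 'Z_p) (i : nat) (s : 'Z_p) : bool :=
  (0 < i < p) && (s == r + i%:R)%R.

(* A walk from 0 is encoded by its edges, each given as (label, target). *)
Definition walk_labels (p : nat) (w : seq (nat * 'Z_p)) : seq nat :=
  [seq e.1 | e <- w].

Definition walk_vertices (p : nat) (w : seq (nat * 'Z_p)) : seq 'Z_p :=
  [seq e.2 | e <- w].

(* Only the target of the dummy pair (0, 0) heading the path is used. *)
Definition is_walk (p : nat) (w : seq (nat * 'Z_p)) : bool :=
  [&& path (fun e f => residue_edge p e.2 f.1 f.2) (0, 0%R) w,
      sorted leq (walk_labels p w)
    & (0%R \notin walk_vertices p w)].

Definition corresponds (p : nat) (la : seq nat) (w : seq (nat * 'Z_p)) : Prop :=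
  [/\ core_p'_partition p la,
      beads_rightmost p la,
      is_walk p w,
      walk_labels p w = flatten [seq nseq (row_mult p la i) i | i <- iota 1 p.-1]
    & walk_vertices p w = residue_seq p la].

Definition is_maximal {T : Type} (P : pred T) (f : T -> nat) (x : T) : Prop :=
  P x /\ forall y, P y -> f y <= f x.

(* Main.v *)
Require Import Defs.
From mathcomp Require Import all_boot all_order all_algebra.
From mathcomp Require Import zify ring.

(* Let [b_j] be the number of beads on runner [j] of a [p]-core, and let
   [0 = c_0 <= ... <= c_(p-1)] be these numbers in increasing order; for a walk
   let [c_i] be the number of edges with label at most [i].  In both cases let
   [k_i] and [d_i] count the [i]-edges leading to vertex 0 from the vertex
   before and after the [i]-edges, so that [c_i - c_(i-1) = k_i - d_i].  Since
   [(i+1) k_(i+1) = i d_i] modulo [p], the values [k_(i+1) - d_i] are distinct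
   modulo [p] for distinct [d_i]; hence for each [i] exactly one pair maximizes
   [k_(i+1) - d_i].  The maximizing pairs satisfy [2 d_i < p < 2 k_(i+1)], so
   they fit together to a walk, and it is the unique longest one.

   Twice the size of the core is a convex quadratic function of [b].  If a pair
   falls short of the maximum by [delta], then its [d_i] exceeds the optimal one
   by at least [-(p-1-i) delta] and at most [(i+1) delta], and this is what makes
   the derivative at [c] in the direction of the optimum nonnegative.  If the
   runners are not sorted, following the longest runner shifts the frame by one
   at every shorter runner to its right; this loss is recovered by rearranging
   the runners in the linear part of the size and from the quadratic part. *)

Set Implicit Arguments.
Unset Strict Implicit.
Unset Printing Implicit Defensive.

Import Order.TTheory GRing.Theory Num.Theory.

(** * Optimal pairs *)

Lemma finite_choice (T : Type) (x0 : T) (P : nat -> T -> Prop) n :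
  (forall i, i < n -> exists x, P i x) ->
  exists f : nat -> T, forall i, i < n -> P i (f i).
Proof.
elim: n => [|n IHn] exP; first by exists (fun=> x0).
have [|f fP] := IHn; first by move=> i /ltnW; apply: exP.
have [x xP] := exP n (ltnSn n).
exists (fun i => if i == n then x else f i) => i.
by rewrite ltnS leq_eqVlt; case: eqP => [-> //|_] /= /fP.
Qed.

(** A pair (d, k) for which some vertex v satisfies v + i d = 0 and v + (i+1) k = 0 in Z/p: vertex 0
    is d edges labelled i, or k edges labelled i+1, away from v. *)
Definition compatible (p i : nat) (x : nat * nat) : bool :=
  [&& 0 < x.1 < p, 0 < x.2 < p & i.+1 * x.2 == i * x.1 %[mod p]].

Lemma compatibleP p i x : reflect
  [/\ 0 < x.1 < p, 0 < x.2 < p & (p%:Z %| (i.+1%:Z * x.2%:Z - i%:Z * x.1%:Z)%R)%Z]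
  (compatible p i x).
Proof.
have -> : compatible p i x = [&& 0 < x.1 < p, 0 < x.2 < p
    & (p%:Z %| (i.+1%:Z * x.2%:Z - i%:Z * x.1%:Z)%R)%Z].
  rewrite /compatible; do 2!congr (_ && _).
  by rewrite -!PoszM -eqz_mod_dvd !modz_nat eqz_nat.
exact: and3P.
Qed.

Lemma best_compatible p i : 0 < i < p.-1 ->
  exists x, compatible p i x /\
    forall y, compatible p i y -> y.2 + x.1 <= x.2 + y.1.
Proof.
move=> lti.
(* The added [p] makes the truncated subtraction exact. *)
pose P (n : nat) := [exists y : 'I_p * 'I_p,
  compatible p i (val y.1, val y.2) && (n == y.2 + p - y.1)].
have exP : exists n, P n.
  have i1p : p - i.+1 < p by lia.
  have ip : p - i < p by lia.
  (* The pair (p-i-1, p-i) is compatible, since (i+1)(p-i) - i(p-i-1) = p. *)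
  exists (p - i + p - (p - i.+1)); apply/existsP.
  exists (Ordinal i1p, Ordinal ip); rewrite /= eqxx andbT.
  apply/compatibleP; split => /=; try lia.
  apply/dvdzP; exists 1%R; rewrite mul1r; nia.
have ubP n : P n -> n <= p + p.
  case/existsP=> -[y1 y2] /= /andP[_ /eqP->]; have := ltn_ord y2; lia.
case: (ex_maxnP exP ubP) => n /existsP[[x1 x2] /= /andP[xP /eqP->]] maxn.
exists (val x1, val x2); split=> // -[y1 y2] yP /=.
have [/= y1p y2p _] := compatibleP _ _ _ yP.
have y1p' : y1 < p by lia.
have y2p' : y2 < p by lia.
have /maxn : P (y2 + p - y1).
  by apply/existsP; exists (Ordinal y1p', Ordinal y2p'); rewrite /= yP eqxx.
have := ltn_ord x1; have := ltn_ord x2; lia.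
Qed.

(* [K i] and [D i] count the [i]-edges that lead from the vertex before and
   after the [i]-edges of a walk to vertex 0; hence [m_i = K i - D i]. *)
Definition optimal (p : nat) (D K : nat -> nat) : Prop :=
  [/\ K 1 = p, D p.-1 = 1,
    forall i, 0 < i < p.-1 -> compatible p i (D i, K i.+1)
  & forall i, 0 < i < p.-1 -> forall y, compatible p i y ->
      y.2 + D i <= K i.+1 + y.1].

Lemma optimal_exists p : 2 < p -> exists D K, optimal p D K.
Proof.
move=> p2.
have [i|f fP] := @finite_choice _ (0, 0) (fun i x => 0 < i -> compatible p i x /\
    forall y, compatible p i y -> y.2 + x.1 <= x.2 + y.1) p.-1.
  case: (posnP i) => [->|i0] ip; first by exists (0, 0).
  have [|x xP] := @best_compatible p i; first by rewrite i0.
  by exists x.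
(* Boundary values: vertex 0 is [p] edges labelled 1 away from itself, and the walk stops one edge
   labelled [p.-1] before vertex 0. *)
exists (fun i => if i == p.-1 then 1 else (f i).1).
exists (fun i => if i == 1 then p else (f i.-1).2).
split; rewrite ?eqxx // => i /andP[i0 ip].
  have [+ _] := fP i ip i0.
  by rewrite ltn_eqF // eqSS gtn_eqF //=; case: (f i).
have [_ +] := fP i ip i0.
by rewrite ltn_eqF // eqSS gtn_eqF.
Qed.

Section Optimum.
Variables (p : nat) (D K : nat -> nat).
Hypotheses (p_prime : prime p) (p_gt2 : 2 < p) (opt : optimal p D K).

Let dvd_p (x y : int) : (p%:Z %| (x * y)%R)%Z = (p%:Z %| x)%Z || (p%:Z %| y)%Z.
Proof. by rewrite !dvdzE abszM Euclid_dvdM. Qed.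

Lemma dvdz_ge0 (x : int) : (p%:Z %| x)%Z -> (- p%:Z < x)%R -> (0 <= x)%R.
Proof.
have p0 : (0 < p%:Z)%R by lia.
case/dvdzP=> q ->; rewrite -mulN1r ltr_pM2r // => q0.
by rewrite mulr_ge0 //; lia.
Qed.

Lemma small_dvdz (x : int) : (p%:Z %| x)%Z -> (- p%:Z < x)%R -> (x < p%:Z)%R -> x = 0%R.
Proof.
move=> dvx lo hi; have x0 := dvdz_ge0 dvx lo.
have : (0 <= - x)%R by apply: dvdz_ge0; [rewrite rpredN | lia].
lia.
Qed.

(** The compatible pair (p-i-1, p-i) has difference 1, so the maximal difference is positive. *)
Lemma optimal_gain i : 0 < i < p.-1 -> D i < K i.+1.
Proof.
move=> lti; case: opt => _ _ _ /(_ i lti (p - i.+1, p - i)) /= H.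
suff /H : compatible p i (p - i.+1, p - i) by lia.
apply/compatibleP; split => /=; try lia.
by apply/dvdzP; exists 1%R; rewrite mul1r; nia.
Qed.

Lemma optimal_half i : 0 < i < p.-1 -> D i + D i < p < K i.+1 + K i.+1.
Proof.
move=> lti; have gain := optimal_gain lti.
case: opt => _ _ /(_ i lti)/compatibleP[/= Dp Kp dv] maxi.
have dbl : (p%:Z %| (i.+1%:Z * (2 * K i.+1)%:Z - i%:Z * (2 * D i)%:Z)%R)%Z.
  by rewrite !PoszM !(mulrCA _ (Posz 2)) -mulrBr dvdz_mull.
have odd2 x : 0 < x < p -> 2 * x != p.
  move=> xp; apply/eqP => E.
  have : 2 %| p by rewrite -E dvdn_mulr.
  by rewrite dvdn_prime2 // => /eqP E2; lia.
have dvp: (p%:Z %| p%:Z)%Z by [].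
(* Doubling a pair that lies entirely in one half and reducing it modulo [p]
   would double the difference [K - D]. *)
have nhi : ~~ (p < 2 * D i).
  apply/negP=> hi.
  have /(maxi i lti) /= : compatible p i (2 * D i - p, 2 * K i.+1 - p).
    apply/compatibleP; split => /=; try lia.
    have -> : (i.+1%:Z * (2 * K i.+1 - p)%:Z - i%:Z * (2 * D i - p)%:Z =
       (i.+1%:Z * (2 * K i.+1)%:Z - i%:Z * (2 * D i)%:Z) - p%:Z)%R by nia.
    by rewrite rpredB.
  lia.
have nlo : ~~ (2 * K i.+1 < p).
  apply/negP=> lo.
  have /(maxi i lti) /= : compatible p i (2 * D i, 2 * K i.+1).
    by apply/compatibleP; split => //=; try lia.
  lia.
have := odd2 _ Dp; have := odd2 _ Kp; lia.
Qed.

(** [D i] comes from the pair at [i] and [K i] from the pair at [i - 1]. They lie on different sides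
    of p/2, so the independently chosen pairs fit together with [D i < K i]. *)
Lemma optimal_bounds i : 0 < i < p ->
  0 < D i /\ D i + D i < p /\ p < K i + K i /\ K i <= p.
Proof.
move=> lti; have [K1 D1 cmp _] := opt.
have [D0 DD] : 0 < D i /\ D i + D i < p.
  case: (eqVneq i p.-1) => [->|ne]; first by rewrite D1; lia.
  have lti' : 0 < i < p.-1 by lia.
  by have := optimal_half lti'; have [/= ? _ _] := compatibleP _ _ _ (cmp i lti'); lia.
split=> //; split=> //.
case: i lti {D0 DD} => [//|[|i]] lti; first by rewrite K1; lia.
have lti' : 0 < i.+1 < p.-1 by lia.
by have := optimal_half lti'; have [/= _ ? _] := compatibleP _ _ _ (cmp _ lti'); lia.
Qed.

Lemma optimal_dvd i : 0 < i < p.-1 -> (p%:Z %| (i.+1%:Z * (K i.+1)%:Z - i%:Z * (D i)%:Z)%R)%Z.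
Proof. by case: opt => _ _ cmp _ /cmp /compatibleP[]. Qed.

Lemma optimal_deviation i (d k : int) : 0 < i < p.-1 ->
  (0 <= d <= p%:Z)%R -> (0 <= k <= p%:Z)%R ->
  ((0 < d) && (0 < k) || (d < p%:Z) && (k < p%:Z))%R ->
  (p%:Z %| (i.+1%:Z * k - i%:Z * d)%R)%Z ->
  let dl := ((K i.+1)%:Z - (D i)%:Z - (k - d))%R in
  [/\ 0 <= dl, - (p.-1 - i)%:Z * dl <= d - (D i)%:Z & d - (D i)%:Z <= i.+1%:Z * dl]%R.
Proof.
move=> lti dp kp dk dv dl.
have dvD := optimal_dvd lti.
have [D0 [DD _]] := optimal_bounds (i := i) (ltac:(lia)).
have gain := optimal_gain lti.
have nd j : 0 < j < p -> (p%:Z %| j%:Z)%Z = false.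
  by move=> jp; rewrite dvdzE /= gtnNdvd //; lia.
(* The entries may be 0 or [p]. The disjunctive hypothesis excludes (0, p) and (p, 0); every other
   boundary pair is impossible or has difference at most 0, below the optimum. *)
have dl0 : (0 <= dl)%R.
  have [d0|d0] := eqVneq d 0%R.
    move: dv; rewrite d0 mulr0 subr0 dvd_p nd ?orFb; last by lia.
    by move/small_dvdz; rewrite /dl d0; lia.
  have [k0|k0] := eqVneq k 0%R.
    have : (p%:Z %| (i%:Z * d)%R)%Z.
      have -> : (i%:Z * d = - (i.+1%:Z * k - i%:Z * d))%R by rewrite k0; ring.
      by rewrite rpredN.
    by rewrite dvd_p nd ?orFb; [move/small_dvdz; rewrite /dl k0; lia | lia].
  have [d1|d1] := eqVneq d (Posz p).
    by rewrite /dl d1; lia.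
  have [k1|k1] := eqVneq k (Posz p).
    have : (p%:Z %| (i%:Z * d)%R)%Z.
      have -> : (i%:Z * d = i.+1%:Z * p%:Z - (i.+1%:Z * k - i%:Z * d))%R by rewrite k1; ring.
      by rewrite rpredB // dvdz_mull.
    by rewrite dvd_p nd ?orFb; [move/small_dvdz; lia | lia].
  case: opt => _ _ _ /(_ i lti (absz d, absz k)) /= H.
  suff /H : compatible p i (absz d, absz k) by rewrite /dl; lia.
  apply/compatibleP; split => /=; try lia.
  by rewrite !gez0_abs //; lia.
(* Subtracting the two congruences gives (i+1) dl = d - D modulo [p]. Since d - D lies strictly
   between -p and p, both bounds follow: a multiple of [p] exceeding -p is nonnegative. *)
have dvdl : (p%:Z %| (i.+1%:Z * dl - (d - (D i)%:Z))%R)%Z.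
  have -> : (i.+1%:Z * dl - (d - (D i)%:Z) =
    (i.+1%:Z * (K i.+1)%:Z - i%:Z * (D i)%:Z) - (i.+1%:Z * k - i%:Z * d))%R.
    by rewrite /dl; lia.
  by rewrite rpredB.
split=> //.
- have : (p%:Z %| ((p.-1 - i)%:Z * dl + (d - (D i)%:Z))%R)%Z.
    have -> : ((p.-1 - i)%:Z * dl + (d - (D i)%:Z) =
      p%:Z * dl - (i.+1%:Z * dl - (d - (D i)%:Z)))%R.
      have -> : ((p.-1 - i)%:Z = p%:Z - i.+1%:Z)%R by lia.
      ring.
    by rewrite rpredB // dvdz_mulr.
  move/dvdz_ge0; have : (0 <= (p.-1 - i)%:Z * dl)%R by rewrite mulr_ge0.
  lia.
- move/dvdz_ge0: dvdl; have : (0 <= i.+1%:Z * dl)%R by rewrite mulr_ge0.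
  lia.
Qed.

End Optimum.

(** * Deviation from the optimal row counts *)

Definition optimal_rows (D K : nat -> nat) (i : nat) : nat :=
  \sum_(1 <= j < i.+1) (K j - D j).

Lemma optimal_rows0 D K : optimal_rows D K 0 = 0.
Proof. by rewrite /optimal_rows big_nil. Qed.

Section Deviation.
Variables (p : nat) (D K : nat -> nat).
Hypotheses (p_prime : prime p) (p_gt2 : 2 < p) (opt : optimal p D K).
Let bs := optimal_rows D K.

Lemma optimal_rowsS i : i.+1 < p -> bs i.+1 + D i.+1 = bs i + K i.+1.
Proof.
move=> ip; have := optimal_bounds p_prime p_gt2 opt (i := i.+1) ip.
rewrite /bs /optimal_rows big_nat_recr //=; lia.
Qed.

Lemma optimal_rows_lt i : i.+1 < p -> bs i < bs i.+1.
Proof.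
move=> ip; have := optimal_bounds p_prime p_gt2 opt (i := i.+1) ip.
have := optimal_rowsS ip; lia.
Qed.

(** The first value is p - D 1, which exceeds p/2, and the values increase. *)
Lemma optimal_rows_ge i : 0 < i < p -> p < 2 * bs i.
Proof.
case: i => // i /= ip; elim: i ip => [|i IHi] ip.
  have := optimal_bounds p_prime p_gt2 opt (i := 1) ip.
  have := optimal_rowsS ip; have [-> _ _ _] := opt.
  rewrite /bs optimal_rows0; lia.
have := IHi (ltnW ip); have := optimal_rows_lt ip; lia.
Qed.

Lemma first_violation i (a t : int) : 0 < i < p ->
  exists k, (0 < k <= p) && (p%:Z %| (i%:Z * (a + k%:Z) - t)%R)%Z.
Proof.
move=> ip; have cop : coprimez i%:Z p%:Z.
  by rewrite coprimezE /= coprime_sym prime_coprime // gtnNdvd //; lia.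
have /coprimezP[[u v] /= uv] := cop.
have p0 : (p%:Z != 0)%R by lia.
(* [u] inverts [i] modulo [p], so a + k has to be congruent to u t; the shift by 1 puts k into 1..p
   instead of 0..p-1. *)
pose y := ((u * t - a - 1) %% p%:Z)%Z.
have y0 : (0 <= y)%R by rewrite modz_ge0.
have yp : (y < p%:Z)%R by rewrite ltz_pmod //; lia.
exists (absz y).+1; apply/andP; split; first by lia.
have -> : ((absz y).+1%:Z = y + 1)%R by lia.
apply/dvdzP; exists (- i%:Z * ((u * t - a - 1) %/ p%:Z)%Z - v * t)%R.
have E := divz_eq (u * t - a - 1)%R p%:Z; rewrite -/y in E.
set q := divz _ _ in E *.
have -> : (y = u * t - a - 1 - q * p%:Z)%R by rewrite E; ring.
have -> : (i%:Z * (a + (u * t - a - 1 - q * p%:Z + 1)) - t =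
  (u * i%:Z) * t - i%:Z * q * p%:Z - t)%R by ring.
have -> : (u * i%:Z = 1 - v * p%:Z)%R by rewrite -uv; ring.
by ring.
Qed.

(** Let [z i] be the first row count beyond [c i.-1] at which [p] divides i z - t i, as if the
    i-edges ran on to vertex 0. Then [z i - c i - sg i] and [z i.+1 - c i - sg i] play the roles of
    [D i] and [K i.+1]; comparing them with the optimal pair and telescoping gives the formula. *)
Lemma deviation (c sg : nat -> int) :
  c 0 = 0%R -> sg 0 = 0%R -> sg p.-1 = 0%R ->
  (forall i, sg i = 0%R \/ sg i = 1%R) ->
  (forall i, 0 < i < p -> (c i.-1 <= c i)%R) ->
  (forall i (r : int), 0 < i < p -> (c i.-1 <= r < c i)%R ->
    ~~ (p%:Z %| (\sum_(0 <= l < i) (r - c l + 1 - sg l))%R)%Z) ->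
  exists dl e : nat -> int, [/\
    forall i, 0 < i < p ->
      ((bs i)%:Z - c i = \sum_(1 <= j < i) dl j + e i + sg i)%R,
    forall i, 0 < i < p.-1 -> [/\ 0 <= dl i, - (p.-1 - i)%:Z * dl i <= e i
      & e i <= i.+1%:Z * dl i]%R
    & (0 <= e p.-1)%R].
Proof.
move=> c0 sg0 sgp sg01 cle nd.
pose t (i : nat) : int := (\sum_(0 <= l < i) (c l + sg l))%R.
have sumE i (r : int) : (\sum_(0 <= l < i) (r - c l + 1 - sg l) = i%:Z * (r + 1) - t i)%R.
  elim: i => [|i IHi]; rewrite /t ?big_nil ?big_nat_recr //=; first by rewrite mul0r subr0.
  by rewrite IHi /t; have -> : (i.+1%:Z = i%:Z + 1)%R by [lia]; ring.
have [i ip|k kP] := @finite_choice _ 0 (fun i k => 0 < i ->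
    (0 < k <= p) && (p%:Z %| (i%:Z * (c i.-1 + k%:Z) - t i)%R)%Z) p.
  case: (posnP i) => [->|i0]; first by exists 0.
  by have [|k kP] := @first_violation i (c i.-1) (t i); [lia | exists k].
have kb i : 0 < i < p -> 0 < k i <= p by move=> /andP[i0 ip]; case/andP: (kP i ip i0).
have kd i : 0 < i < p -> (p%:Z %| (i%:Z * (c i.-1 + (k i)%:Z) - t i)%R)%Z.
  by move=> /andP[i0 ip]; case/andP: (kP i ip i0).
pose z (i : nat) : int := (c i.-1 + (k i)%:Z)%R.
(* Otherwise the row [z i - 1] would violate the hypothesis on rows between [c i.-1] and [c i]. *)
have zgt i : 0 < i < p -> (c i < z i)%R.
  move=> ip; rewrite ltNge; apply/negP=> zle.
  have zr : (c i.-1 <= z i - 1 < c i)%R by have := kb i ip; rewrite /z in zle *; lia.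
  by have /negP := nd i _ ip zr; apply; rewrite sumE subrK; apply: kd.
have z1 : z 1 = Posz p.
  have t1 : t 1 = 0%R by rewrite /t big_nat1 c0 sg0.
  have := kd 1 ltac:(lia); have := kb 1 ltac:(lia).
  rewrite /z /= c0 t1 subr0 dvdzE => kp; have -> : (1%:Z * (0 + (k 1%N)%:Z) = k 1%N)%R by lia.
  move=> /= dv; have : p <= k 1 by apply: dvdn_leq => //; lia.
  lia.
have zdv i : 0 < i < p.-1 -> (p%:Z %| (i.+1%:Z * (z i.+1 - c i - sg i) - i%:Z * (z i - c i - sg i))%R)%Z.
  move=> ip.
  have -> : (i.+1%:Z * (z i.+1 - c i - sg i) - i%:Z * (z i - c i - sg i) =
    (i.+1%:Z * z i.+1 - t i.+1) - (i%:Z * z i - t i))%R.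
    rewrite /t big_nat_recr //=; have -> : (i.+1%:Z = i%:Z + 1)%R by [lia]; ring.
  by rewrite rpredB //; apply: kd; lia.
pose d (i : nat) : int := (z i - c i - sg i)%R.
exists (fun i => (K i.+1)%:Z - (D i)%:Z - (z i.+1 - z i))%R, (fun i => d i - (D i)%:Z)%R.
split.
- case=> // i /= ip; elim: i ip => [|i IHi] ip.
    rewrite big_geq // /d z1; have := @optimal_rowsS 0 ip.
    rewrite /bs optimal_rows0; have [-> _ _ _] := opt; lia.
  have := IHi (ltnW ip); rewrite [in X in _ -> X]big_nat_recr //= /d.
  have := optimal_rowsS ip; have := optimal_rowsS (ltnW ip); 
  set S := (\sum_(1 <= j < i.+1) _)%R; move: S => S; lia.
- move=> i ip.
  have dk : (z i.+1 - z i = (z i.+1 - c i - sg i) - d i)%R by rewrite /d; ring.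
  rewrite dk; apply: (optimal_deviation p_prime p_gt2 opt ip); last exact: zdv.
  + have := zgt i; have := kb i; have := cle i; have := sg01 i; rewrite /d /z; lia.
  + have := kb i.+1; have := sg01 i; rewrite /z /=; lia.
  (* If [sg i] is 0 both entries are positive, and if it is 1 both are less than [p]; so the mixed
     boundary pairs do not occur. *)
  + have := zgt i; have := kb i; have := cle i; have := kb i.+1; have := sg01 i; rewrite /d /z /=; lia.
- have [_ -> _ _] := opt; have := zgt p.-1; rewrite /d sgp; lia.
Qed.
End Deviation.

(** * Rearrangement *)

Lemma abel_summation (n : nat) (a c : nat -> int) :
  (\sum_(0 <= l < n.+1) a l * c l = (\sum_(0 <= l < n.+1) a l) * c n
    - \sum_(1 <= i < n.+1) (\sum_(0 <= l < i) a l) * (c i - c i.-1))%R.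
Proof.
elim: n => [|n IHn]; first by rewrite !big_nat1 big_geq // subr0.
rewrite [LHS]big_nat_recr // IHn (big_nat_recr n.+1 1) //= (big_nat_recr n.+1 0) //=.
by ring.
Qed.

(** After sorting, the entry at index i of a list of distinct naturals is at least i. *)
Lemma sum_uniq_ge (s : seq nat) : uniq s ->
  \sum_(0 <= l < size s) l <= \sum_(x <- s) x.
Proof.
move=> Us; rewrite -(perm_big _ (permEl (perm_sort leq s))) -(size_sort leq) /=.
have: sorted ltn (sort leq s) by rewrite ltn_sorted_uniq_leq sort_uniq Us sort_sorted.
move: (sort leq s) => {Us}s ss.
suff le_nth i : i < size s -> i <= nth 0 s i.
  by rewrite [leqRHS](big_nth 0) [leqLHS]big_nat [leqRHS]big_nat; apply: leq_sum => i /andP[_ /le_nth].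
elim: i => [//|i IHi] ltis.
apply: leq_ltn_trans (IHi (ltnW ltis)) _.
by rewrite (sorted_ltn_nth ltn_trans) // inE // ltnW.
Qed.

Section Rearrangement.
Variables (p : nat) (rho : nat -> nat) (c : nat -> int).
Hypotheses (rho_inj : {in gtn p &, injective rho})
  (rho_sum : \sum_(0 <= l < p) rho l = \sum_(0 <= l < p) l).

Lemma partial_sums i : i <= p ->
  (\sum_(0 <= l < i) (l%:Z - (rho l)%:Z) <= 0)%R.
Proof.
move=> ip; rewrite sumrB subr_le0.
rewrite -!(big_morph Posz PoszD (erefl _)) lez_nat.
have -> : \sum_(0 <= l < i) rho l = \sum_(x <- map rho (iota 0 i)) x.
  by rewrite big_map /index_iota subn0.
have szm : size (map rho (iota 0 i)) = i by rewrite size_map size_iota.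
rewrite -{1}szm; apply: sum_uniq_ge; rewrite map_inj_in_uniq ?iota_uniq //.
move=> x y; rewrite !mem_iota => /andP[_ xi] /andP[_ yi]; apply: rho_inj; rewrite inE.
  exact: leq_trans ip.
exact: leq_trans ip.
Qed.

(** Summation by parts; the boundary term vanishes because [rho] and the identity have the same sum.
    By [partial_sums] the coefficients of the gaps of [c] are nonnegative. *)
Lemma rearrangement_gap :
  (\sum_(0 <= l < p) (l%:Z - (rho l)%:Z) * c l =
   \sum_(1 <= i < p) (- \sum_(0 <= l < i) (l%:Z - (rho l)%:Z)) * (c i - c i.-1))%R.
Proof.
case: p rho_sum => [|n] sumn0; first by rewrite !big_geq.
rewrite abel_summation sumrB -!(big_morph Posz PoszD (erefl _)) sumn0 subrr mul0r sub0r.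
by rewrite -sumrN; apply: eq_bigr => i _; rewrite mulNr.
Qed.

Lemma rearrangement :
  (forall i, 0 < i < p -> (c i.-1 <= c i)%R) ->
  (0 <= \sum_(0 <= l < p) (l%:Z - (rho l)%:Z) * c l)%R.
Proof.
move=> cle; rewrite rearrangement_gap big_nat; apply: sumr_ge0 => i ip.
rewrite mulr_ge0 ?subr_ge0 ?cle // oppr_ge0 partial_sums //; lia.
Qed.

(** Strictly positive gaps force every partial sum to vanish, and successive partial sums then give
    [rho i = i]. *)
Lemma rearrangement_eq :
  (forall i, 0 < i < p -> (c i.-1 < c i)%R) ->
  (\sum_(0 <= l < p) (l%:Z - (rho l)%:Z) * c l = 0)%R ->
  forall i, i < p -> rho i = i.
Proof.
move=> clt; rewrite rearrangement_gap big_nat => /eqP; rewrite psumr_eq0; last first.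
  move=> i ip; apply: mulr_ge0; last by rewrite subr_ge0 ltW ?clt.
  by rewrite oppr_ge0 partial_sums //; lia.
move=> /allP sum0.
have S0 i : i <= p -> (\sum_(0 <= l < i) (l%:Z - (rho l)%:Z) = 0)%R.
  case: (posnP i) => [->|i0 ip]; first by rewrite big_geq.
  have [->|nip] := eqVneq i p.
    by rewrite sumrB -!(big_morph Posz PoszD (erefl _)) rho_sum subrr.
  have ip' : 0 < i < p by lia.
  have /sum0 : i \in index_iota 1 p by rewrite mem_index_iota.
  rewrite ip' /= mulf_eq0 oppr_eq0 subr_eq0 => /orP[/eqP //|/eqP ec].
  by have := clt i ip'; rewrite ec ltxx.
move=> i ip; have := S0 i.+1 ip; rewrite big_nat_recr //= S0 ?(ltnW ip) //; lia.
Qed.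

End Rearrangement.

Lemma perm_map_iota (p : nat) (f : nat -> nat) :
  {in gtn p &, injective f} -> (forall l, l < p -> f l < p) ->
  perm_eq (map f (iota 0 p)) (iota 0 p).
Proof.
move=> f_inj f_lt.
have Uf : uniq (map f (iota 0 p)).
  rewrite map_inj_in_uniq ?iota_uniq // => x y; rewrite !mem_iota => xp yp.
  by apply: f_inj.
apply: uniq_perm => //; first exact: iota_uniq.
have [||//] := uniq_min_size Uf (s2 := iota 0 p); last by rewrite size_map.
by move=> _ /mapP[x + ->]; rewrite !mem_iota /= add0n; apply: f_lt.
Qed.

Lemma sum_perm_iota (R : nmodType) (p : nat) (f : nat -> nat) (F : nat -> R) :
  perm_eq (map f (iota 0 p)) (iota 0 p) ->
  (\sum_(0 <= l < p) F (f l) = \sum_(0 <= l < p) F l)%R.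
Proof.
move=> pf; rewrite /index_iota subn0 -[RHS](perm_big _ pf) /=.
by rewrite big_map.
Qed.

(** * Inequalities for the quadratic size function *)

Lemma sum_id (n : nat) : (2 * \sum_(0 <= l < n) l%:Z = n%:Z * (n%:Z - 1))%R.
Proof.
elim: n => [|n IHn]; first by rewrite big_geq.
by rewrite big_nat_recr //= mulrDr IHn; have -> : (n.+1%:Z = n%:Z + 1)%R by [lia]; ring.
Qed.

(** Cauchy-Schwarz against the constant vector. The index starts at 1 because runner 0 never
    contributes to [h]. *)
Lemma square_sum_le (n : nat) (h : nat -> int) :
  ((\sum_(0 <= l < n) h l.+1) ^+ 2 <= n%:Z * \sum_(0 <= l < n) (h l.+1) ^+ 2)%R.
Proof.
set S := (\sum_(0 <= l < n) h l.+1)%R; set Q := (\sum_(0 <= l < n) (h l.+1) ^+ 2)%R.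
case: (posnP n) => [n0|n0]; first by rewrite /S /Q n0 !big_geq.
have : (0 <= \sum_(0 <= l < n) (n%:Z * h l.+1 - S) ^+ 2)%R.
  by apply: sumr_ge0 => l _; rewrite sqr_ge0.
have -> : (\sum_(0 <= l < n) (n%:Z * h l.+1 - S) ^+ 2 = n%:Z * (n%:Z * Q - S ^+ 2))%R.
  transitivity (\sum_(0 <= l < n) (n%:Z ^+ 2 * (h l.+1) ^+ 2 + (- 2 * n%:Z * S) * h l.+1 + S ^+ 2))%R.
    by apply: eq_bigr => l _; ring.
  rewrite !big_split /= -!mulr_sumr sumr_const_nat subn0 -/S -/Q -[(_ *+ n)%R]mulr_natl natz.
  by ring.
by rewrite pmulr_rge0 ?subr_ge0 //; lia.
Qed.

(** Summation by parts turns the [dl] part into minus the prefix sums of [g] times [dl]. As [g]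
    increases and sums to 0, the prefix sum through i is at most (i+1) g i and at most -(n-i) g i;
    the one matching the sign of [g i] balances the bound on [e i]. *)
Lemma gradient_ge0 (n : nat) (g u dl e : nat -> int) :
  {in gtn n.+1 &, {homo g : i j / i <= j >-> (i <= j)%R}} ->
  (\sum_(0 <= l < n.+1) g l = 0)%R ->
  u 0 = 0%R ->
  (forall i, 0 < i < n.+1 -> u i = (\sum_(1 <= j < i) dl j + e i)%R) ->
  (forall i, 0 < i < n -> [/\ 0 <= dl i, - (n - i)%:Z * dl i <= e i
      & e i <= i.+1%:Z * dl i]%R) ->
  (0 <= e n)%R ->
  (0 <= \sum_(0 <= l < n.+1) g l * u l)%R.
Proof.
move=> gle gsum u0 uE dle en.
case: n => [|n] in gle gsum uE dle en *; first by rewrite big_nat1 u0 mulr0.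
pose E (i : nat) : int := (\sum_(1 <= j < i) dl j)%R.
have EE (i : nat) : (E i.+2 - E i.+1 = dl i.+1)%R by rewrite /E big_nat_recr //= addrAC subrr add0r.
have E0 : E 0 = 0%R by rewrite /E big_geq.
have E1 : E 1 = 0%R by rewrite /E big_geq.
pose P (i : nat) : int := (\sum_(0 <= l < i) g l)%R.
have -> : (\sum_(0 <= l < n.+2) g l * u l =
    \sum_(0 <= l < n.+2) g l * E l + \sum_(1 <= i < n.+2) g i * e i)%R.
  rewrite [LHS]big_ltn // u0 [X in (_ = X + _)%R]big_ltn // E0 !mulr0 !add0r.
  rewrite -big_split /= !big_nat; apply: eq_bigr => i ip.
  by rewrite uE // mulrDr.
rewrite abel_summation gsum mul0r sub0r big_ltn //= E1 E0 subrr mulr0 add0r.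
rewrite big_add1 /= [X in (_ + X)%R]big_nat_recr //= -sumrN addrA -big_split /=.
have gle' i j : i <= j -> j < n.+2 -> (g i <= g j)%R.
  by move=> ij jn; apply: gle => //; rewrite inE; apply: leq_ltn_trans jn.
have Pup i : i < n.+2 -> (P i.+1 <= i.+1%:Z * g i)%R.
  move=> ip; rewrite /P big_nat; apply: le_trans (_ : (\sum_(0 <= l < i.+1) g i <= _)%R).
    by rewrite [leRHS]big_nat; apply: ler_sum => l li; apply: gle' => //; lia.
  by rewrite sumr_const_nat subn0 -[(_ *+ i.+1)%R]mulr_natl natz.
have Plo i : i < n.+2 -> (P i.+1 <= - ((n.+1 - i)%:Z * g i))%R.
  move=> ip; have : (P i.+1 + \sum_(i.+1 <= l < n.+2) g l = 0)%R by rewrite -big_cat_nat.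
  have : ((n.+1 - i)%:Z * g i <= \sum_(i.+1 <= l < n.+2) g l)%R.
    apply: le_trans (_ : (_ <= \sum_(i.+1 <= l < n.+2) g i)%R) _.
      by rewrite sumr_const_nat subSS -[(_ *+ (n.+1 - i))%R]mulr_natl natz.
    by rewrite [leLHS]big_nat [leRHS]big_nat; apply: ler_sum => l li; apply: gle' => //; lia.
  lia.
apply: addr_ge0.
  rewrite big_nat; apply: sumr_ge0 => -[//|i] /= ip.
  have [dl0 lo hi] := dle i.+1 ip; rewrite EE -/(P i.+2).
  have := Pup i.+1 (ltnW ip); have := Plo i.+1 (ltnW ip).
  case: (leP 0%R (g i.+1)) => [g0|/ltW g0] P1 P2.
    have : (g i.+1 * (- (n.+1 - i.+1)%:Z * dl i.+1) <= g i.+1 * e i.+1)%R by rewrite ler_wpM2l.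
    have : (P i.+2 * dl i.+1 <= - ((n.+1 - i.+1)%:Z * g i.+1) * dl i.+1)%R by rewrite ler_wpM2r.
    lia.
  have : (g i.+1 * (i.+2%:Z * dl i.+1) <= g i.+1 * e i.+1)%R by rewrite ler_wnM2l.
  have : (P i.+2 * dl i.+1 <= i.+2%:Z * g i.+1 * dl i.+1)%R by rewrite ler_wpM2r.
  lia.
apply: mulr_ge0 => //.
(* The total, which is 0, is at most [n.+2] times the last and largest term, so that term is
   nonnegative. *)
have := Pup n.+1 (ltnSn _); rewrite /P gsum pmulr_rge0 //; lia.
Qed.

(** * The size of a core *)

(* Twice the size of the [p]-core whose runner [rho l] holds [c l] beads. *)
Definition core_size2 (p : nat) (rho : nat -> nat) (c : nat -> int) : int :=
  (p%:Z * \sum_(0 <= l < p) c l ^+ 2 - p%:Z * \sum_(0 <= l < p) c l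
   + 2 * \sum_(0 <= l < p) (rho l)%:Z * c l
   - (\sum_(0 <= l < p) c l) ^+ 2 + \sum_(0 <= l < p) c l)%R.

Section CoreBound.
Variables (p : nat) (b c : nat -> int) (rho : nat -> nat) (dl e : nat -> int).
Let top := rho p.-1.
(** Marks the runners to the right of the longest one: a position on the longest runner is reached
    before the position of these runners in the same row. *)
Let sg l : int := (top < rho l)%N%:Z.
Hypotheses (p_gt0 : 0 < p) (b0 : b 0 = 0%R)
  (b_lt : forall i, 0 < i < p -> (b i.-1 < b i)%R)
  (b_ge : forall i, 0 < i < p -> (p%:Z < 2 * b i)%R)
  (c0 : c 0 = 0%R) (c_le : forall i, 0 < i < p -> (c i.-1 <= c i)%R)
  (rho0 : rho 0 = 0) (rho_inj : {in gtn p &, injective rho})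
  (rho_lt : forall l, l < p -> rho l < p)
  (dev : forall i, 0 < i < p -> (b i - c i = \sum_(1 <= j < i) dl j + e i + sg i)%R)
  (dle : forall i, 0 < i < p.-1 ->
    [/\ 0 <= dl i, - (p.-1 - i)%:Z * dl i <= e i & e i <= i.+1%:Z * dl i]%R)
  (e_ge0 : (0 <= e p.-1)%R).

Let h l := (b l - c l)%R.
(** The partial derivatives at [c] of the quadratic form [core_size2 p id]. *)
Let grad l : int :=
  (2 * p%:Z * c l - 2 * (\sum_(0 <= l < p) c l) + 2 * l%:Z - p%:Z + 1)%R.

Let sum1 : (\sum_(0 <= l < p) 1 = p%:Z)%R.
Proof. by rewrite sumr_const_nat subn0 natz. Qed.

(** The exact second-order expansion at [c] in direction [h], plus the effect of replacing [rho] by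
    the identity in the linear part. *)
Lemma core_size2_diff :
  (core_size2 p id b - core_size2 p rho c =
   \sum_(0 <= l < p) grad l * h l
   + (p%:Z * \sum_(0 <= l < p) h l ^+ 2 - (\sum_(0 <= l < p) h l) ^+ 2)
   + 2 * \sum_(0 <= l < p) (l%:Z - (rho l)%:Z) * c l)%R.
Proof.
have bE (l : nat) : (b l = c l + h l)%R by rewrite /h; ring.
rewrite /core_size2; under eq_bigr do rewrite bE.
rewrite (eq_bigr (fun l => c l ^+ 2 + 2 * (c l * h l) + h l ^+ 2)%R); last by move=> *; ring.
under [X in (_ - _ * X + _ - _ + _)%R]eq_bigr do rewrite bE.
under [X in (_ - X ^+ 2 + _)%R]eq_bigr do rewrite bE.
under [X in (_ - _ ^+ 2 + X)%R]eq_bigr do rewrite bE.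
have -> : (\sum_(0 <= l < p) l%:Z * b l =
   \sum_(0 <= l < p) l%:Z * c l + \sum_(0 <= l < p) l%:Z * h l)%R.
  by rewrite -big_split; apply: eq_bigr => l _ /=; rewrite bE; ring.
have -> : (\sum_(0 <= l < p) grad l * h l =
   2 * p%:Z * (\sum_(0 <= l < p) c l * h l) + 2 * (\sum_(0 <= l < p) l%:Z * h l)
   + (1 - p%:Z - 2 * \sum_(0 <= l < p) c l) * \sum_(0 <= l < p) h l)%R.
  rewrite /grad; set C := (\sum_(0 <= l < p) c l)%R.
  by rewrite !mulr_sumr -!big_split; apply: eq_bigr => l _ /=; ring.
have -> : (\sum_(0 <= l < p) (l%:Z - (rho l)%:Z) * c l =
  \sum_(0 <= l < p) l%:Z * c l - \sum_(0 <= l < p) (rho l)%:Z * c l)%R.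
  by rewrite -sumrB; apply: eq_bigr => l _; ring.
rewrite !big_split /= -!mulr_sumr; ring.
Qed.

(** Adding one bead to every runner does not change the size, so the derivative in that direction
    vanishes. *)
Lemma grad_sum : (\sum_(0 <= l < p) grad l = 0)%R.
Proof.
rewrite /grad; set C := (\sum_(0 <= l < p) c l)%R.
transitivity (\sum_(0 <= l < p) (2 * p%:Z * c l + 2 * l%:Z + (1 - p%:Z - 2 * C) * 1))%R.
  by apply: eq_bigr => l _; ring.
rewrite !big_split /= -!mulr_sumr sum1 sum_id -/C; ring.
Qed.

Lemma c_mono i j : i <= j -> j < p -> (c i <= c j)%R.
Proof.
elim: j => [|j IHj]; first by rewrite leqn0 => /eqP->.
rewrite leq_eqVlt => /orP[/eqP-> //|ij] jp.
by apply: le_trans (IHj ij (ltnW jp)) _; apply: (c_le (i := j.+1)).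
Qed.

Lemma sg0 : sg 0 = 0%R.
Proof. by rewrite /sg rho0. Qed.

Lemma gradient_part :
  (\sum_(0 <= l < p) grad l * sg l <= \sum_(0 <= l < p) grad l * h l)%R.
Proof.
have pE : p = p.-1.+1 by lia.
rewrite -subr_ge0 -sumrB.
under eq_bigr do rewrite -mulrBr.
(* The direction is [h - sg], which by [dev] has the required form. *)
rewrite pE; apply: (gradient_ge0 (dl := dl) (e := e)); rewrite -?pE //.
- move=> i j; rewrite !inE => ip jp ij; have := c_mono ij jp; rewrite /grad; nia.
- exact: grad_sum.
- by rewrite /h b0 c0 sg0 !subr0.
- by move=> i ip; rewrite /h dev //; ring.
Qed.

(** Since [h 0] is 0, only p-1 terms count in Cauchy-Schwarz, which leaves one full sum of squares
    over. *)
Lemma square_part :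
  (\sum_(0 <= l < p) h l ^+ 2 <=
   p%:Z * \sum_(0 <= l < p) h l ^+ 2 - (\sum_(0 <= l < p) h l) ^+ 2)%R.
Proof.
have pE : p = p.-1.+1 by lia.
have h0 : h 0 = 0%R by rewrite /h b0 c0 subr0.
rewrite pE !big_nat_recl // h0 expr0n !add0r.
have := square_sum_le p.-1 h.
set S := (\sum_(_ <= _ < _) h _)%R; set Q := (\sum_(_ <= _ < _) h _ ^+ 2)%R.
have -> : (p.-1.+1%:Z = p.-1%:Z + 1)%R by lia.
by rewrite mulrDl mul1r; lia.
Qed.

(* Rotating [rho] so that the runners to the right of the longest one come
   directly after runner 0. *)
Let rot l := if l == 0 then 0 else
  if top < rho l then rho l - top else rho l + (p.-1 - top).

Lemma top_lt : top < p.
Proof. by apply: rho_lt; lia. Qed.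

Lemma rho_gt0 l : 0 < l < p -> 0 < rho l.
Proof.
move=> /andP[l0 lp]; rewrite lt0n; apply/eqP => rl.
by have := rho_inj (x := l) (y := 0); rewrite !inE rho0 rl => /(_ lp p_gt0 erefl); lia.
Qed.

Lemma rot_inj : {in gtn p &, injective rot}.
Proof.
move=> x y; rewrite !inE => xp yp; have tp := top_lt.
have := rho_lt xp; have := rho_lt yp; have := rho_gt0 (l := x); have := rho_gt0 (l := y).
rewrite /rot; case: (eqVneq x 0) => [->|x0]; case: (eqVneq y 0) => [->|y0] //.
- case: ifP; lia.
- case: ifP; lia.
- move=> ry rx ryp rxp E; apply: rho_inj => //; move: E; do 2!case: ifP; lia.
Qed.

Lemma rot_lt l : l < p -> rot l < p.
Proof.
move=> lp; have := rho_lt lp; have := top_lt.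
by rewrite /rot; case: eqP => // _; case: ifP; lia.
Qed.

Lemma sg_sum : (\sum_(0 <= l < p) sg l = (p.-1 - top)%:Z)%R.
Proof.
rewrite /sg (sum_perm_iota (fun j => Posz (top < j)) (perm_map_iota rho_inj rho_lt)).
have tp := top_lt; rewrite (big_cat_nat _ (n := top.+1)) //=.
rewrite big_nat big1 ?add0r; last by move=> i ip; rewrite ltnNge; lia.
rewrite big_nat (eq_bigr (fun=> 1%R)); last by move=> i /andP[-> _].
by rewrite -big_nat sumr_const_nat natz; congr Posz; lia.
Qed.

(** For l > 0, [rho l] is rot l + (p-1) sg l - (p-1-top). The products of the sums of [c] and [sg]
    cancel against the gradient, and only terms local to the marked runners remain. *)
Lemma rotation_part :
  (\sum_(0 <= l < p) grad l * sg l + 2 * \sum_(0 <= l < p) (l%:Z - (rho l)%:Z) * c l =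
   2 * \sum_(0 <= l < p) (l%:Z - (rot l)%:Z) * c l
   + \sum_(0 <= l < p) sg l * (2 * c l + 2 * l%:Z - p%:Z + 1))%R.
Proof.
have rotE l : 0 <= l < p -> ((l%:Z - (rho l)%:Z) * c l = (l%:Z - (rot l)%:Z) * c l
    - (p%:Z - 1) * (sg l * c l) + (p.-1 - top)%:Z * c l)%R.
  move=> lp; have tp := top_lt; rewrite /rot /sg; case: eqP => [->|_].
    by rewrite c0 !mulr0 subr0 addr0.
  have E : ((p.-1 - top)%:Z = p%:Z - 1 - top%:Z)%R by lia.
  case: ltnP => tr /=; rewrite ?PoszD E.
    by have -> : ((rho l - top)%:Z = (rho l)%:Z - top%:Z)%R by [lia]; ring.
  by ring.
rewrite (eq_big_nat _ _ rotE) big_split sumrB -!mulr_sumr /= -sg_sum.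
have -> : (\sum_(0 <= l < p) grad l * sg l =
   2 * p%:Z * (\sum_(0 <= l < p) sg l * c l) + (\sum_(0 <= l < p) sg l * (2 * l%:Z - p%:Z + 1))
   - 2 * (\sum_(0 <= l < p) c l) * (\sum_(0 <= l < p) sg l))%R.
  rewrite /grad; set C := (\sum_(0 <= l < p) c l)%R.
  by rewrite !mulr_sumr -!big_split -sumrB; apply: eq_bigr => l _ /=; ring.
have -> : (\sum_(0 <= l < p) sg l * (2 * c l + 2 * l%:Z - p%:Z + 1) =
   2 * (\sum_(0 <= l < p) sg l * c l) + \sum_(0 <= l < p) sg l * (2 * l%:Z - p%:Z + 1))%R.
  by rewrite !mulr_sumr -!big_split; apply: eq_bigr => l _ /=; ring.
ring.
Qed.

(** On a marked runner, substituting c = b - h gives (h-1)^2 + (2b - p) + 2l, which is positive. *)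
Lemma residual_ge0 l : l < p ->
  (0 <= sg l * (2 * c l + 2 * l%:Z - p%:Z + 1) + h l ^+ 2
     ?= iff (h l == 0) && (sg l == 0))%R.
Proof.
move=> lp; rewrite /sg; case: ltnP => tr /=; last first.
  by rewrite mul0r add0r andbT; split; rewrite ?sqr_ge0 // eq_sym expf_eq0.
have l0 : 0 < l by rewrite lt0n; apply: contraTneq tr => ->; rewrite rho0.
have := b_ge (i := l); rewrite l0 lp => /(_ isT) bl.
have cE : (c l = b l - h l)%R by rewrite /h; ring.
rewrite andbF mul1r; apply/leifP; rewrite cE.
have : (0 <= (h l - 1) ^+ 2)%R by exact: sqr_ge0.
have -> : ((h l - 1) ^+ 2 = h l ^+ 2 - 2 * h l + 1)%R by ring.
lia.
Qed.

(** The difference is at least twice a rearrangement sum plus the residual terms, all nonnegative.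
    In case of equality [h] and [sg] vanish, so the longest runner is rightmost, [rot] agrees with
    [rho], and the strict growth of [b] forces the identity. *)
Lemma core_size2_le :
  (core_size2 p rho c <= core_size2 p id b)%R /\
  (core_size2 p rho c = core_size2 p id b ->
   forall l, l < p -> c l = b l /\ rho l = l).
Proof.
have diff := core_size2_diff.
have grp := gradient_part; have sqp := square_part; have rtp := rotation_part.
have rsum : \sum_(0 <= l < p) rot l = \sum_(0 <= l < p) l.
  exact: (sum_perm_iota id (perm_map_iota rot_inj rot_lt)).
have rea := rearrangement rot_inj rsum c_le.
pose res l := (sg l * (2 * c l + 2 * l%:Z - p%:Z + 1) + h l ^+ 2)%R.
have resE : (\sum_(0 <= l < p) res l = \sum_(0 <= l < p) sg l * (2 * c l + 2 * l%:Z - p%:Z + 1)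
   + \sum_(0 <= l < p) h l ^+ 2)%R by rewrite -big_split.
have res0 : (0 <= \sum_(0 <= l < p) res l)%R.
  by rewrite big_nat; apply: sumr_ge0 => l /andP[_ lp]; case: (residual_ge0 lp).
split; first by lia.
move=> eqs.
have : (\sum_(0 <= l < p) res l = 0)%R by lia.
have rot0 : (\sum_(0 <= l < p) (l%:Z - (rot l)%:Z) * c l = 0)%R by lia.
rewrite big_nat => /eqP; rewrite psumr_eq0; last first.
  by move=> l /andP[_ lp]; case: (residual_ge0 lp).
move=> /allP all0.
have hs l : l < p -> h l = 0%R /\ sg l = 0%R.
  move=> lp; have /all0 : l \in index_iota 0 p by rewrite mem_index_iota.
  by rewrite lp /= eq_sym; case: (residual_ge0 lp) => _ -> /andP[/eqP-> /eqP->].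
have cb l : l < p -> c l = b l by move=> /hs[]; rewrite /h; lia.
have ttop : p.-1 - top = 0.
  have := sg_sum; rewrite big_nat big1; first by lia.
  by move=> l /andP[_ /hs[]].
move=> l lp; split; first exact: cb.
have := rearrangement_eq rot_inj rsum _ rot0 lp; rewrite /rot ttop.
have -> : top < rho l = false.
  by have [_] := hs l lp; rewrite /sg; case: ltnP.
case: eqP => [-> //|_]; rewrite addn0; apply=> i ip.
by rewrite !cb //; [apply: b_lt | lia | lia].
Qed.

End CoreBound.

(** * Gaps and bead counts *)

(* The number of gaps before position [r * p + j] when each runner [l] holds
   [b l] beads in its topmost positions. *)
Definition gaps_before (p : nat) (b : nat -> nat) (j r : nat) : nat :=
  \sum_(0 <= l < p) (r + (l < j) - b l).

Lemma leq_mono_nat (p : nat) (c : nat -> nat) :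
  (forall i, 0 < i < p -> c i.-1 <= c i) ->
  forall i j, i <= j -> j < p -> c i <= c j.
Proof.
move=> cle i; elim=> [|j IHj]; first by rewrite leqn0 => /eqP->.
rewrite leq_eqVlt => /orP[/eqP-> //|ij] jp.
by apply: leq_trans (IHj ij (ltnW jp)) _; apply: (cle j.+1).
Qed.

Lemma sum_PoszE (m n : nat) (F : nat -> nat) :
  ((\sum_(m <= l < n) F l)%N%:Z = \sum_(m <= l < n) (F l)%:Z)%R.
Proof. by rewrite (big_morph Posz PoszD (erefl _)). Qed.

(** In such a row the runners from [i] on have no gaps yet, and a shorter runner contributes its gap
    in row [r] itself exactly if it lies left of the longest runner. *)
Lemma gaps_before_block (p : nat) (c rho : nat -> nat) (i r : nat) :
  (forall i, 0 < i < p -> c i.-1 <= c i) ->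
  {in gtn p &, injective rho} ->
  0 < i < p -> c i.-1 <= r < c i ->
  ((\sum_(0 <= l < p) (r + (rho l < rho p.-1) - c l))%N%:Z =
   \sum_(0 <= l < i) (r%:Z - (c l)%:Z + 1 - (rho p.-1 < rho l)%N%:Z))%R.
Proof.
move=> cle rinj ip /andP[rlo rhi]; have cmono := leq_mono_nat cle.
rewrite (big_cat_nat _ (n := i)) //=; last by lia.
rewrite [X in (_ + X)%N]big_nat [X in (_ + X)%N]big1 ?addn0; last first.
  by move=> l lp; have := cmono i l; case: (rho l < _); lia.
rewrite sum_PoszE; apply: eq_big_nat => l li.
have cl : c l <= r by apply: leq_trans rlo; apply: cmono; lia.
have : rho l != rho p.-1.
  by apply/eqP=> /rinj; rewrite !inE => E; have : l = p.-1 by [apply: E; lia]; lia.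
case: ltngtP => //=; lia.
Qed.

Lemma sorting_exists (p : nat) (b : nat -> nat) : 0 < p -> b 0 = 0 ->
  exists rho, [/\ rho 0 = 0, perm_eq (map rho (iota 0 p)) (iota 0 p)
    & forall i, 0 < i < p -> b (rho i.-1) <= b (rho i)].
Proof.
move=> p0 b0; pose s := 0 :: sort (relpre b leq) (iota 1 p.-1).
have szs : size s = p by rewrite /= size_sort size_iota prednK.
exists (nth 0 s); split=> //.
  have {1}<- : size s = p by [].
  rewrite -/(mkseq _ _) mkseq_nth.
  by rewrite -[in iota _ p](prednK p0) /s /= perm_cons perm_sort.
move=> [//|i] /= ip.
have srt : sorted (relpre b leq) s.
  have /= : sorted (relpre b leq) (sort (relpre b leq) (iota 1 p.-1)).
    by apply: sort_sorted => x y; apply: leq_total.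
  by rewrite /s; case: (sort _ _) => //= x t ->; rewrite b0 andbT.
have tr : transitive (relpre b leq) by move=> y x z; apply: leq_trans.
have := sorted_ltn_nth tr 0 srt i i.+1; rewrite !inE szs /=.
by apply; lia.
Qed.

Lemma perm_iota_inj (p : nat) (f : nat -> nat) :
  perm_eq (map f (iota 0 p)) (iota 0 p) ->
  {in gtn p &, injective f} /\ (forall l, l < p -> f l < p).
Proof.
move=> pf; split=> [x y|l lp]; last first.
  have : f l \in iota 0 p by rewrite -(perm_mem pf) map_f // mem_iota.
  by rewrite mem_iota.
rewrite !inE => xp yp fxy.
have Uf : uniq (map f (iota 0 p)) by rewrite (perm_uniq pf) iota_uniq.
have nf z : z < p -> nth 0 (map f (iota 0 p)) z = f z.
  by move=> zp; rewrite (nth_map 0) ?size_iota // nth_iota.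
apply/eqP; rewrite -(nth_uniq 0 _ _ Uf) ?size_map ?size_iota // !nf //.
exact/eqP.
Qed.

(** * Comparison of cores and walks with the optimum *)

Section Domination.
Variables (p : nat) (D K : nat -> nat).
Hypotheses (p_prime : prime p) (p_gt2 : 2 < p) (opt : optimal p D K).
Let bs := optimal_rows D K.

Lemma optimal_rows_le i : 0 < i < p -> bs i.-1 <= bs i.
Proof. by case: i => //= i ip; apply/ltnW/(optimal_rows_lt p_prime p_gt2 opt). Qed.

(** The runners are sorted by length, and the gap condition is read along the longest one; this
    supplies the hypotheses of [deviation], whose output feeds [core_size2_le]. *)
Lemma core_domination (b : nat -> nat) : b 0 = 0 ->
  (forall j r, j < p -> r < b j -> ~~ (p %| gaps_before p b j r)) ->
  let size2 c := core_size2 p id (fun l => Posz (c l)) in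
  (size2 b <= size2 bs)%R /\ (size2 b = size2 bs -> forall j, j < p -> b j = bs j).
Proof.
move=> b0 valid size2; have p0 : 0 < p by lia.
have [rho [rho0 prho ble]] := sorting_exists p0 b0.
have [rinj rlt] := perm_iota_inj prho.
pose c l := b (rho l).
have toplt : rho p.-1 < p by apply: rlt; lia.
have sizeE : core_size2 p rho (fun l => Posz (c l)) = size2 b.
  have eq4 F : (\sum_(0 <= l < p) F (rho l) = \sum_(0 <= l < p) F l :> int)%R.
    exact: sum_perm_iota.
  rewrite /size2 /core_size2 /c (eq4 (fun l => (b l)%:Z ^+ 2)%R) (eq4 (fun l => Posz (b l))).
  by rewrite (eq4 (fun l => l%:Z * (b l)%:Z)%R).
have [||||||dl [e [dev dle e0]]] := @deviation p D K p_prime p_gt2 opt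
    (fun l => Posz (c l)) (fun l => Posz (rho p.-1 < rho l)).
- by rewrite /c rho0 b0.
- by rewrite rho0.
- by rewrite ltnn.
- by move=> i; case: (_ < _); [right | left].
- by move=> i ip; rewrite lez_nat /c ble.
- move=> i [r|r] ip; last by lia.
  rewrite !lez_nat ltz_nat => rc.
  rewrite -(gaps_before_block (c := c)) //.
  rewrite dvdzE /= /c.
  rewrite (_ : \sum_(0 <= l < p) _ = gaps_before p b (rho p.-1) r).
    apply: valid => //; case/andP: rc => _ rc; apply: leq_trans rc _.
    by apply: (leq_mono_nat (p := p) (c := c)) => //; lia.
  rewrite /gaps_before.
  exact: (sum_perm_iota (fun l => r + (l < rho p.-1) - b l) prho).
have [|||||le_size eq_size] := @core_size2_le p (fun l => Posz (bs l)) (fun l => Posz (c l)) rho dl e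
  p0 _ _ _ _ _ rho0 rinj rlt dev dle e0.
- by rewrite /bs optimal_rows0.
- by case=> //= i ip; rewrite ltz_nat (optimal_rows_lt p_prime p_gt2 opt).
- move=> i ip; have := optimal_rows_ge p_prime p_gt2 opt ip; rewrite -/bs; lia.
- by rewrite /c rho0 b0.
- by move=> i ip; rewrite lez_nat /c ble.
rewrite -sizeE; split=> // /eq_size cb j jp.
by have [[cbj] rj] := cb j jp; rewrite -cbj /c rj.
Qed.

(** Here [sg] is 0, and the deviation at [p.-1] is a sum of nonnegative terms. Equality makes every
    [dl] vanish, and the two-sided bounds then make every [e i] with i < p-1 vanish. *)
Lemma walk_domination (c : nat -> nat) : c 0 = 0 ->
  (forall i, 0 < i < p -> c i.-1 <= c i) ->
  (forall r, r < c p.-1 -> ~~ (p %| gaps_before p c p.-1 r)) ->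
  c p.-1 <= bs p.-1 /\ (c p.-1 = bs p.-1 -> forall j, j < p -> c j = bs j).
Proof.
move=> c0 cle valid.
have [||||||dl [e [dev dle e0]]] := @deviation p D K p_prime p_gt2 opt
    (fun l => Posz (c l)) (fun=> 0%R) => //.
- by rewrite c0.
- by move=> i; left.
- move=> i [r|r] ip; last by lia.
  rewrite !lez_nat ltz_nat => rc.
  have -> : (\sum_(0 <= l < i) (r%:Z - (c l)%:Z + 1 - 0) =
     \sum_(0 <= l < i) (r%:Z - (c l)%:Z + 1 - (p.-1 < l)%N%:Z))%R.
    by apply: eq_big_nat => l li; rewrite ltnNge (_ : l <= p.-1) //; lia.
  rewrite -(gaps_before_block (rho := id) cle) // dvdzE /=.
  apply: valid; case/andP: rc => _ rc; apply: leq_trans rc _.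
  by apply: (leq_mono_nat cle); lia.
have p1 : 0 < p.-1 < p by lia.
have := dev _ p1; rewrite addr0.
have dl0 : (0 <= \sum_(1 <= j < p.-1) dl j)%R.
  by rewrite big_nat; apply: sumr_ge0 => i /dle[].
rewrite -/bs => devp; split; first by lia.
move=> cb; have : (\sum_(1 <= j < p.-1) dl j = 0)%R by lia.
rewrite big_nat => /eqP; rewrite psumr_eq0; last by move=> i /dle[].
move/allP=> all0.
have dl_eq0 i : 0 < i < p.-1 -> dl i = 0%R.
  move=> ip; have /all0 : i \in index_iota 1 p.-1 by rewrite mem_index_iota.
  by rewrite ip => /eqP.
move=> [|j] jp; first by rewrite c0 /bs optimal_rows0.
have [->//|jp1] := eqVneq j.+1 p.-1.
have := dev j.+1 jp; rewrite big_nat big1 => [|i ij]; last by apply: dl_eq0; lia.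
have jp2 : 0 < j.+1 < p.-1 by lia.
by have [_] := dle _ jp2; rewrite dl_eq0 // !mulr0 -/bs; lia.
Qed.

(** With i least such that [r < bs i], the gap count is congruent to -i (bs i + D i - r - 1) modulo
    [p]. *)
Lemma optimal_rows_valid j r : j < p -> r < bs j -> ~~ (p %| gaps_before p bs j r).
Proof.
move=> jp rb.
have [i /andP[ij rbi] imin] : exists2 i, (i <= j) && (r < bs i)
    & forall i', (i' <= j) && (r < bs i') -> i <= i'.
  have exi : exists i, (i <= j) && (r < bs i) by exists j; rewrite leqnn.
  by exists (ex_minn exi); case: ex_minnP.
have i0 : 0 < i by case: (i) rbi => //; rewrite /bs optimal_rows0.
have ip : 0 < i < p by lia.
have rlo : bs i.-1 <= r.
  by rewrite leqNgt; apply/negP=> h; have := imin i.-1; rewrite h; lia.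
have bmono := leq_mono_nat optimal_rows_le.
have E : ((gaps_before p bs j r)%:Z = \sum_(0 <= l < i) (r%:Z + 1 - (bs l)%:Z))%R.
  rewrite /gaps_before (big_cat_nat _ (n := i)) //=; last by lia.
  rewrite [X in (_ + X)%N]big_nat [X in (_ + X)%N]big1 ?addn0; last first.
    by move=> l lp; have := bmono i l; case: (l < j); lia.
  rewrite sum_PoszE; apply: eq_big_nat => l li.
  have bl : bs l <= r by apply: leq_trans rlo; apply: bmono; lia.
  by have -> : l < j by [lia]; lia.
(* [bs i' + D i'] is the row count at which prolonged i'-edges would reach vertex 0; the
   compatibility congruences add up to this. *)
have dvz i' : 0 < i' < p ->
    (p%:Z %| (i'%:Z * ((bs i')%:Z + (D i')%:Z) - \sum_(0 <= l < i') (bs l)%:Z)%R)%Z.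
  case: i' => // i'; elim: i' => [|i' IHi'] ip'.
    have := optimal_rowsS p_prime p_gt2 opt (i := 0) ip'; have [-> _ _ _] := opt.
    rewrite -/bs big_nat1 /bs optimal_rows0 => /= E1.
    by have -> : (1 * ((optimal_rows D K 1%N)%:Z + (D 1%N)%:Z) - 0%N%:Z = p%:Z)%R by [lia]; exact: dvdzz.
  have dvK := optimal_dvd opt (i := i'.+1) ltac:(lia).
  have st := rpredD dvK (IHi' ltac:(lia)).
  have E1 := optimal_rowsS p_prime p_gt2 opt ip'; rewrite -/bs in E1.
  rewrite big_nat_recr //=; set S := (\sum_(0 <= l < i'.+1) _)%R in st *.
  have -> : (i'.+2%:Z * ((bs i'.+2)%:Z + (D i'.+2)%:Z) - (S + (bs i'.+1)%:Z) =
    i'.+2%:Z * (K i'.+2)%:Z - i'.+1%:Z * (D i'.+1)%:Z +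
    (i'.+1%:Z * ((bs i'.+1)%:Z + (D i'.+1)%:Z) - S))%R.
    have -> : ((bs i'.+2)%:Z = (bs i'.+1)%:Z + (K i'.+2)%:Z - (D i'.+2)%:Z)%R by lia.
    by have -> : (i'.+2%:Z = i'.+1%:Z + 1)%R by [lia]; ring.
  exact: st.
have -> : (p %| gaps_before p bs j r) = (p%:Z %| (gaps_before p bs j r)%:Z)%Z.
  by rewrite dvdzE.
apply/negP=> /rpredB/(_ (dvz i ip)).
rewrite E sumrB sumr_const_nat subn0 -[(_ *+ i)%R]mulr_natl natz.
have -> : (i%:Z * (r%:Z + 1) - \sum_(0 <= l < i) (bs l)%:Z -
   (i%:Z * ((bs i)%:Z + (D i)%:Z) - \sum_(0 <= l < i) (bs l)%:Z) =
   - (i * (bs i + D i - r.+1))%N%:Z)%R.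
  have -> : ((i * (bs i + D i - r.+1))%N%:Z = i%:Z * ((bs i)%:Z + (D i)%:Z - r%:Z - 1))%R.
    by rewrite PoszM; congr (_ * _)%R; lia.
  ring.
(* The second factor is at least [D i > 0] and, since [bs i.-1 <= r], at most K i - 1, which is less
   than [p]. *)
rewrite rpredN dvdzE /= Euclid_dvdM // gtnNdvd //= ?gtnNdvd //; try lia.
all: have := optimal_bounds p_prime p_gt2 opt ip.
all: have := optimal_rowsS p_prime p_gt2 opt (i := i.-1); rewrite prednK // -/bs; lia.
Qed.

End Domination.

(** * Walks *)

(** Runners from [j] on have no gap through row [r], so every bead of the row sees the same gaps,
    namely those up to the end of the row. *)
Lemma gaps_before_row_end (p : nat) (c : nat -> nat) (j r : nat) :
  (forall i, 0 < i < p -> c i.-1 <= c i) -> j < p -> r < c j ->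
  gaps_before p c j r = \sum_(0 <= l < p) (r.+1 - c l).
Proof.
move=> cle jp rc; apply: eq_big_nat => l /andP[_ lp].
have := leq_mono_nat cle (i := j) (j := l); case: ltnP => lj; last by lia.
lia.
Qed.

Lemma sum_sub_count (p : nat) (c : nat -> nat) (r : nat) :
  \sum_(0 <= l < p) (r.+1 - c l) =
  \sum_(0 <= l < p) (r - c l) + count (fun l => c l <= r) (iota 0 p).
Proof.
elim: p => [|p IHp]; first by rewrite !big_geq.
rewrite -[in iota 0 p.+1]addn1 iotaD count_cat !big_nat_recr //= IHp.
by rewrite /= addn0; case: (leqP (c p) r); lia.
Qed.

Lemma Zp_nat_eq0 (p n : nat) : 1 < p -> (n%:R == 0 :> 'Z_p)%R = (p %| n).
Proof. by move=> p1; rewrite -val_eqE /= val_Zp_nat. Qed.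

Lemma count_ltn_iota (p n : nat) : n <= p -> count (fun l => l < n) (iota 0 p) = n.
Proof.
move=> np; rewrite -(subnKC np) iotaD count_cat add0n.
rewrite (_ : count _ (iota 0 n) = n); last first.
  rewrite -[RHS](size_iota 0) -[RHS](count_predT); apply: eq_in_count => l.
  by rewrite mem_iota.
rewrite (_ : count _ _ = 0) ?addn0 //; apply/eqP; rewrite -leqn0 leqNgt -has_count.
by apply/hasPn => l; rewrite mem_iota -leqNgt => /andP[].
Qed.

Lemma sorted_flatten_nseq (s : seq nat) (n : nat) : sorted leq s ->
  (forall x, x \in s -> 0 < x <= n) ->
  s = flatten [seq nseq (count_mem i s) i | i <- iota 1 n].
Proof.
move=> ss sn.
have cnt x m : count_mem x (flatten [seq nseq (count_mem i s) i | i <- iota 1 m]) =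
    if 0 < x <= m then count_mem x s else 0.
  elim: m => [|m IHm]; first by rewrite /=; case: ifP => //; lia.
  rewrite -[m.+1]addn1 iotaD map_cat flatten_cat count_cat IHm /= cats0 count_nseq add1n /=.
  rewrite addn1; case: eqVneq => [<-|nx] /=; rewrite ?mul0n ?mul1n.
    by rewrite ltnn leqnn.
  by do 2!case: ifP; lia.
have srt m : sorted leq (flatten [seq nseq (count_mem i s) i | i <- iota 1 m]).
  elim: m => [//|m IHm].
  rewrite -[m.+1]addn1 iotaD map_cat flatten_cat /= cats0 add1n.
  rewrite sorted_pairwise; last exact: leq_trans.
  rewrite pairwise_cat -!sorted_pairwise; try exact: leq_trans.
  rewrite IHm /=; apply/andP; split; last first.
    by elim: (count_mem _ s) => //= k; case: k => //= k ->; rewrite leqnn.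
  apply/allrelP => x y xm; rewrite mem_nseq => /andP[_ /eqP->].
  have : 0 < count_mem x (flatten [seq nseq (count_mem i s) i | i <- iota 1 m]).
    by rewrite -has_count has_pred1.
  by rewrite cnt; case: ifP => //; lia.
apply: (sorted_eq leq_trans anti_leq) => //.
apply/allP => x _ /=; rewrite cnt; case: ifP => // xn; apply/eqP/count_memPn.
by apply/negP => /sn; rewrite xn.
Qed.

(** Each row containing beads becomes an edge: the label counts the gaps in the row, the target
    those through its end. For sorted runners the last one determines the number of such rows. *)
Definition walk_of (p : nat) (c : nat -> nat) : seq (nat * 'Z_p) :=
  mkseq (fun r => (count (fun l => c l <= r) (iota 0 p),
                   (\sum_(0 <= l < p) (r.+1 - c l))%N%:R%R)) (c p.-1).

Lemma is_walk_of (p : nat) (c : nat -> nat) : 1 < p -> c 0 = 0 ->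
  (forall i, 0 < i < p -> c i.-1 <= c i) ->
  (forall r, r < c p.-1 -> ~~ (p %| gaps_before p c p.-1 r)) ->
  is_walk p (walk_of p c).
Proof.
move=> p1 c0 cle valid; have szw : size (walk_of p c) = c p.-1 by rewrite size_mkseq.
have pE : iota 0 p = 0 :: iota 1 p.-1 by rewrite -{1}(@prednK p) //; lia.
have pE' : iota 0 p = iota 0 p.-1 ++ [:: p.-1].
  by rewrite {1}(_ : p = p.-1 + 1) ?iotaD //; lia.
apply/and3P; split.
- apply/(pathP (0, 0%R)) => r; rewrite szw => rc.
  have -> : (nth (0, 0%R) ((0, 0%R) :: walk_of p c) r).2 =
      ((\sum_(0 <= l < p) (r - c l))%N%:R)%R.
    case: r rc => [|r] rc /=; last by rewrite nth_mkseq // ltnW.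
    by rewrite big1_seq // => l _; rewrite sub0n.
  rewrite nth_mkseq // /residue_edge /= -natrD -sum_sub_count eqxx andbT.
  (* The label is positive because runner 0 is empty, and less than [p] because runner [p.-1] still
     has a bead in row [r]. *)
  apply/andP; split; first by rewrite pE /= c0.
  rewrite pE' count_cat /= [c p.-1 <= r]leqNgt rc /= !addn0.
  by apply: leq_ltn_trans (count_size _ _) _; rewrite size_iota; lia.
- rewrite /walk_labels -map_comp.
  apply: (homo_sorted (e := leq)); last exact: iota_sorted.
  by move=> x y xy; apply: sub_count => l /= /leq_trans; apply.
- rewrite /walk_vertices -map_comp; apply/mapP => -[r]; rewrite mem_iota => /andP[_ rc] /esym/eqP.
  rewrite /= Zp_nat_eq0 // -(gaps_before_row_end cle (j := p.-1)) //; last by lia.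
  exact/negP/valid.
Qed.

(** Take [c i] to be the number of edges labelled at most i. As labels increase, [lab r <= i] holds
    exactly if [r < c i], so [c] recovers the labels, and the targets follow by induction. *)
Lemma walkE (p : nat) (w : seq (nat * 'Z_p)) : 1 < p -> is_walk p w ->
  exists c : nat -> nat, [/\ c 0 = 0, forall i, 0 < i < p -> c i.-1 <= c i,
    forall r, r < c p.-1 -> ~~ (p %| gaps_before p c p.-1 r),
    c p.-1 = size w & w = walk_of p c].
Proof.
move=> p1 /and3P[/(pathP (0, 0%R)) wpath wsort wn0].
pose lab r := (nth (0, 0%R) w r).1.
pose c i := count (fun x => x <= i) (walk_labels p w).
have edge r : r < size w -> 0 < lab r < p.
  by move=> /wpath /andP[].
have labE r : r < size w -> nth 0 (walk_labels p w) r = lab r.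
  by move=> rw; rewrite (nth_map (0, 0%R)).
have cmono i j : i <= j -> c i <= c j.
  by move=> ij; apply: sub_count => x /= /leq_trans; apply.
have labc r i : r < size w -> (lab r <= i) = (r < c i).
  move=> rw; rewrite -labE // /c.
  have := wsort; have : r < size (walk_labels p w) by rewrite size_map.
  elim: (walk_labels p w) r {rw} => [//|x s IHs] [|r] /= rs xs.
    case: (leqP x i) => xi //; symmetry; rewrite /= add0n -has_count; apply/negbTE/hasPn => y ys.
    by rewrite -ltnNge; apply: leq_trans xi _; move/(order_path_min leq_trans)/allP: xs; apply.
  case: (leqP x i) => xi; first by rewrite add1n ltnS IHs // (path_sorted xs).
  have := order_path_min leq_trans xs => /allP xmin.
  have -> : count (fun y => y <= i) s = 0.
    apply/eqP; rewrite -leqn0 leqNgt -has_count; apply/hasPn => y /xmin xy.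
    by rewrite -ltnNge; apply: leq_trans xy.
  apply/negbTE; rewrite -ltnNge; apply: leq_trans xi _.
  by apply: xmin; rewrite mem_nth.
have cp : c p.-1 = size w.
  rewrite /c -[RHS](size_map fst) -[RHS]count_predT; apply: eq_in_count => x /(nthP 0)[r].
  by rewrite size_map => rw; rewrite labE // => <- /=; have := edge r rw; lia.
have c0 : c 0 = 0.
  apply/eqP; rewrite -leqn0 leqNgt -has_count; apply/hasPn => x /(nthP 0)[r].
  by rewrite size_map => rw; rewrite labE // => <-; have := edge r rw; lia.
have cle i : 0 < i < p -> c i.-1 <= c i by move=> _; apply: cmono; lia.
have labcount r : r < size w -> count (fun l => c l <= r) (iota 0 p) = lab r.
  move=> rw; rewrite -[RHS](@count_ltn_iota p); last by have := edge r rw; lia.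
  by apply: eq_count => l; rewrite ltnNge labc // -leqNgt.
have vert r : r < size w ->
    (nth (0, 0%R) w r).2 = ((\sum_(0 <= l < p) (r.+1 - c l))%N%:R)%R.
  elim: r => [|r IHr] rw.
    have := wpath 0 rw => /andP[_ /eqP->] /=; rewrite sum_sub_count natrD labcount //.
    by rewrite big1_seq.
  have := wpath r.+1 rw => /andP[_ /eqP->] /=; rewrite IHr 1?ltnW //.
  by rewrite [in RHS]sum_sub_count natrD labcount.
exists c; split=> //.
- move=> r; rewrite cp => rw; rewrite (gaps_before_row_end cle); try lia.
  rewrite -Zp_nat_eq0 // -vert //; apply: contra wn0 => /eqP <-.
  by apply/mapP; exists (nth (0, 0%R) w r); rewrite ?mem_nth.
- apply: (@eq_from_nth _ (0, 0%R)); first by rewrite size_mkseq.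
  move=> r rw.
  by rewrite nth_mkseq ?cp // labcount // -vert // /lab; case: (nth _ w r).
Qed.

(** * Beads and hooks *)

Lemma count_mem_sym (s t : seq nat) : uniq s -> uniq t ->
  count (mem s) t = count (mem t) s.
Proof.
move=> Us Ut; rewrite -!size_filter; apply: perm_size.
apply: uniq_perm; rewrite ?filter_uniq // => x.
by rewrite !mem_filter /= andbC.
Qed.

Definition bead (la : seq nat) (k : nat) : nat := nth 0 la k + (size la - k.+1).

Section Beads.
Variable la : seq nat.
Hypothesis la_part : is_partition la.

Lemma part_gt0 k : k < size la -> 0 < nth 0 la k.
Proof.
move=> kl; have /andP[_ n0] := la_part; rewrite lt0n; apply: contra n0 => /eqP <-.
exact: mem_nth.
Qed.

Lemma part_geq i j : i <= j -> nth 0 la j <= nth 0 la i.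
Proof.
move=> ij; have [jl|jl] := ltnP j (size la); last by rewrite [leqLHS]nth_default.
have /andP[srt _] := la_part.
have trg : transitive geq by move=> y x z xy yz; apply: leq_trans yz xy.
have reg : reflexive geq by move=> x /=.
by apply: (sorted_leq_nth trg reg 0 srt) => //; rewrite inE; apply: leq_ltn_trans jl.
Qed.

Lemma bead_lt i j : i < j -> j < size la -> bead la j < bead la i.
Proof. by move=> ij jl; rewrite /bead; have := part_geq (ltnW ij); lia. Qed.

Lemma bead_inj i j : i < size la -> j < size la -> bead la i = bead la j -> i = j.
Proof.
move=> il jl E; case: (ltngtP i j) => // ij.
  by have := bead_lt ij jl; lia.
by have := bead_lt ij il; lia.
Qed.

Lemma beadsP n : reflect (exists2 k, k < size la & n = bead la k) (n \in beads la).
Proof.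
apply: (iffP mapP) => -[k]; last by move=> kl ->; exists k; rewrite ?mem_iota.
by rewrite mem_iota => /andP[_ kl] ->; exists k.
Qed.

Lemma mem_bead k : k < size la -> bead la k \in beads la.
Proof. by move=> kl; apply/beadsP; exists k. Qed.

Lemma size_beads : size (beads la) = size la.
Proof. by rewrite size_mkseq. Qed.

Lemma nth_beads k : k < size la -> nth 0 (beads la) k = bead la k.
Proof. by move=> kl; rewrite nth_mkseq. Qed.

Lemma beads_uniq : uniq (beads la).
Proof.
rewrite map_inj_in_uniq ?iota_uniq // => i j.
by rewrite !mem_iota => /andP[_ il] /andP[_ jl]; apply: bead_inj.
Qed.

Lemma zero_notin_beads : 0 \notin beads la.
Proof. by apply/beadsP => -[k kl]; rewrite /bead; have := part_gt0 kl; lia. Qed.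

(** The beads below the [k]-th are those of the [size la - k.+1] later parts; the other positions
    below it are gaps. *)
Lemma bead_part_bead k : k < size la -> bead_part la (bead la k) = nth 0 la k.
Proof.
move=> kl; rewrite /bead_part.
have := count_predC (mem (beads la)) (iota 0 (bead la k)); rewrite size_iota.
rewrite count_mem_sym ?beads_uniq ?iota_uniq //.
rewrite count_map.
have -> : count (preim (fun k => nth 0 la k + (size la - k.+1)) (mem (iota 0 (bead la k))))
    (iota 0 (size la)) = count (fun j => k < j) (iota 0 (size la)).
  apply: eq_in_count => j; rewrite mem_iota /= mem_iota /= => jl.
  rewrite add0n -/(bead la j); case: (ltngtP k j) => [kj|jk|->]; last by rewrite ltnn.
    by rewrite bead_lt.
  by have := bead_lt jk kl; lia.
have := count_predC (fun j => j < k.+1) (iota 0 (size la)); rewrite size_iota.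
rewrite count_ltn_iota //.
rewrite (@eq_count _ (predC _) (fun j => k < j)); last by move=> j /=; rewrite -leqNgt.
rewrite /bead (@eq_count _ (predC _) (fun n => n \notin beads la)) //.
lia.
Qed.

Lemma sumn_beads : 2 * \sum_(n <- beads la) n = 2 * sumn la + size la * (size la).-1.
Proof.
rewrite big_map big_split /= mulnDr; congr (2 * _ + _).
  by rewrite sumnE [RHS](big_nth 0) /index_iota subn0.
have -> : \sum_(j <- iota 0 (size la)) (size la - j.+1) = \sum_(0 <= j < size la) j.
  by rewrite [RHS]big_nat_rev /index_iota subn0 /=; apply: eq_bigr => j _; rewrite add0n.
have := sum_id (size la); rewrite -sum_PoszE; 
set S := bigop.body _ _ _; case: (size la) S => [|m] S; nia.
Qed.

(* The hook of the cell [(i, j)] runs from the [i]-th bead down to the gap with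
   exactly [j] smaller gaps. *)
Let leg j := count (fun x => j < x) la.
Let gap j := j + size la - leg j.

Lemma leg_ltE k j : k < size la -> (j < nth 0 la k) = (k < leg j).
Proof.
rewrite /leg; have /andP[srt _] := la_part.
elim: la srt k => [//|x s IHs] srt [|k] /= kl.
  case: ltnP => xj //=; symmetry; rewrite add0n -has_count.
  apply/negbTE/hasPn => y ys; rewrite -leqNgt; apply: leq_trans xj.
  have trg : transitive geq by move=> u v w uv vw; apply: leq_trans vw uv.
  by move: srt => /(order_path_min trg)/allP/(_ y ys).
case: (ltnP j x) => xj; first by rewrite add1n ltnS IHs // (path_sorted srt).
have trg : transitive geq by move=> u v w uv vw; apply: leq_trans vw uv.
have small y : y \in s -> y <= j.
  by move=> ys; apply: leq_trans xj; move: srt => /(order_path_min trg)/allP/(_ y ys).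
have -> : count (fun y => j < y) s = 0.
  by apply/eqP; rewrite -leqn0 leqNgt -has_count; apply/hasPn => y /small; rewrite -leqNgt.
by apply/negbTE; rewrite -leqNgt small ?mem_nth.
Qed.

Lemma leg_le j : leg j <= size la. Proof. exact: count_size. Qed.

Lemma hookE i j : i < size la -> j < nth 0 la i ->
  hook la i j + gap j = bead la i.
Proof.
move=> il ji; rewrite /hook /gap /bead -/(leg j).
have := leg_le j; have := leg_ltE j il; rewrite ji => /esym; lia.
Qed.

Lemma gap_notin j : gap j \notin beads la.
Proof.
apply/beadsP => -[k kl]; rewrite /gap /bead.
have := leg_le j; have := leg_ltE j kl; case: ltnP; lia.
Qed.

Lemma gapP i g : i < size la -> g < bead la i -> g \notin beads la ->
  exists2 j, j < nth 0 la i & g = gap j.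
Proof.
move=> il gi ng.
pose N := count (fun k => g < bead la k) (iota 0 (size la)).
have NE k : k < size la -> (g < bead la k) = (k < N).
  move=> kl; rewrite /N.
  apply/idP/idP => [gk|].
    have -> : k.+1 = count (fun l => l < k.+1) (iota 0 (size la)) by rewrite count_ltn_iota.
    rewrite [leqRHS](eq_in_count (a2 := predI (gtn (size la)) (fun l => g < bead la l))); last first.
      by move=> l; rewrite mem_iota /= => ->.
    rewrite [leqLHS](eq_in_count (a2 := predI (gtn (size la)) (fun l => l < k.+1))); last first.
      by move=> l; rewrite mem_iota /= => ->.
    apply: sub_count => l /= /andP[-> lk] /=.
    have [->//|lk'] := eqVneq l k.
    by apply: ltn_trans gk _; apply: bead_lt => //; lia.
  apply: contraTT; rewrite -!leqNgt => kg.
  have -> : k = count (fun l => l < k) (iota 0 (size la)) by rewrite count_ltn_iota // ltnW.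
  rewrite [leqRHS](eq_in_count (a2 := predI (gtn (size la)) (fun l => l < k))); last first.
    by move=> l; rewrite mem_iota /= => ->.
  rewrite [leqLHS](eq_in_count (a2 := predI (gtn (size la)) (fun l => g < bead la l))); last first.
    by move=> l; rewrite mem_iota /= => ->.
  apply: sub_count => l /= /andP[ll gl]; rewrite ll ltnNge; apply/negP => kl'.
  move: kl'; rewrite leq_eqVlt => /orP[/eqP kl'|kl']; first by rewrite -kl' in gl; lia.
  by have := bead_lt kl' ll; lia.
have Nle : N <= size la by rewrite -[leqRHS](size_iota 0); apply: count_size.
have neq k : k < size la -> g != bead la k.
  by move=> kl; apply: contra ng => /eqP->; apply: mem_bead.
have iN : i < N by rewrite -NE.
have gN : size la - N <= g.
  case: (ltnP N (size la)) => NS; last by lia.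
  by have := NE N NS; have := neq N NS; rewrite ltnn /bead; lia.
(* [N] beads lie above [g], hence [size la - N] below it, and [j] counts the gaps below [g]. *)
pose j := g - (size la - N).
have legN : leg j = N.
  apply/eqP; rewrite eqn_leq; apply/andP; split.
    case: (ltnP N (size la)) => NS; last by have := leg_le j; lia.
    rewrite leqNgt -leg_ltE //.
    by have := NE N NS; have := neq N NS; rewrite ltnn /bead /j; lia.
  have N1 : N.-1 < size la by lia.
  have -> : N = N.-1.+1 by lia.
  by rewrite -leg_ltE //; have := NE N.-1 N1; rewrite /bead /j; lia.
exists j; last by rewrite /gap legN /j; lia.
by rewrite leg_ltE // legN.
Qed.

(** A gap [p] places below a bead gives a hook of length [p]. Conversely, with a hook of length q p
    the bead could slide down q times onto the gap of that hook. *)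
Lemma p_coreP p : 0 < p ->
  reflect (forall n, n \in beads la -> p <= n -> n - p \in beads la) (p_core p la).
Proof.
move=> p0; apply: (iffP allP) => [core n /beadsP[i il ->] pn | flush h].
  apply/negPn/negP => ng.
  have [|j ji gE] := gapP il _ ng; first by lia.
  have /core : hook la i j \in hooks la.
    by apply/allpairsPdep; exists i, j; rewrite !mem_iota.
  have := hookE il ji; rewrite -gE => hE.
  have -> : hook la i j = p by lia.
  by rewrite dvdnn.
case/allpairsPdep=> i [j []]; rewrite !mem_iota /= !add0n => il ji ->.
apply/negP => /dvdnP[q hE]; have := hookE il ji; rewrite hE.
have down m : bead la i = m * p + (bead la i - m * p) -> bead la i - m * p \in beads la.
  elim: m => [|m IHm] E; first by rewrite subn0; apply: mem_bead.
  have : bead la i - m * p - p \in beads la by apply: flush; [apply: IHm|]; lia.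
  by have -> : bead la i - m * p - p = bead la i - m.+1 * p by lia.
move=> E; have /negP := gap_notin j; apply.
by have -> : gap j = bead la i - q * p by [lia]; apply: down; lia.
Qed.

Lemma p'_partsP p :
  reflect (forall n, n \in beads la -> ~~ (p %| bead_part la n)) (p'_parts p la).
Proof.
apply: (iffP allP) => [H n /beadsP[k kl ->]|H x /(nthP 0)[k kl <-]].
  by rewrite bead_part_bead // H // mem_nth.
by rewrite -bead_part_bead // H // mem_bead.
Qed.

End Beads.

Lemma eq_partition (la mu : seq nat) : is_partition la -> is_partition mu ->
  beads la =i beads mu -> la = mu.
Proof.
move=> Pla Pmu E.
have srt nu : is_partition nu -> sorted gtn (beads nu).
  move=> Pnu; apply/(sortedP 0) => k; rewrite size_beads => kn.
  by rewrite !nth_beads ?(ltnW kn) //; apply: bead_lt.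
have bE : beads la = beads mu.
  apply: (irr_sorted_eq (leT := gtn)) => //; try exact: srt.
  - by move=> y x z /= yx zy; apply: ltn_trans yx.
  - by move=> x; rewrite /= ltnn.
have szE : size la = size mu by rewrite -size_beads bE size_beads.
apply: (@eq_from_nth _ 0) => // k kl.
have := nth_beads kl; rewrite bE nth_beads -?szE // /bead szE; lia.
Qed.

(** * Cores on the abacus *)

Definition runner_positions (p : nat) (b : nat -> nat) : seq nat :=
  [seq r * p + j | j <- iota 0 p, r <- iota 0 (b j)].

Lemma mem_runner_positions p b n : 0 < p ->
  (n \in runner_positions p b) = (n %/ p < b (n %% p)).
Proof.
move=> p0; apply/allpairsPdep/idP => [[j [r []]]|nb].
  rewrite !mem_iota /= !add0n => jp rb ->.
  by rewrite divnMDl // divn_small // addn0 modnMDl modn_small.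
exists (n %% p), (n %/ p); rewrite !mem_iota /= !add0n ltn_pmod //.
by split=> //; apply: divn_eq.
Qed.

Lemma runner_positions_uniq p b : uniq (runner_positions p b).
Proof.
apply: allpairs_uniq_dep; first exact: iota_uniq.
  by move=> j _; apply: iota_uniq.
move=> _ _ /allpairsPdep[j [r [jp _ ->]]] /allpairsPdep[j' [r' [jp' _ ->]]] /=.
move: jp jp'; rewrite !mem_iota /= !add0n => jp jp' E.
have p0 : 0 < p by lia.
have jj : j = j' by have := congr1 (modn^~ p) E; rewrite /= !modnMDl !modn_small.
have rr : r = r' by have := congr1 (divn^~ p) E; rewrite /= !divnMDl // !divn_small // !addn0.
by rewrite jj rr.
Qed.

Lemma perm_runner_positions p b s : 0 < p -> uniq s ->
  (forall n, (n \in s) = (n %/ p < b (n %% p))) -> perm_eq s (runner_positions p b).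
Proof.
move=> p0 Us sE; apply: uniq_perm => // [|n]; first exact: runner_positions_uniq.
by rewrite sE mem_runner_positions.
Qed.

Lemma count_geq_iota b m : count (fun r => b <= r) (iota 0 m) = m - b.
Proof.
elim: m => [|m IHm]; first by rewrite sub0n.
by rewrite -addn1 iotaD count_cat IHm /= addn0 add0n; case: (leqP b m); lia.
Qed.

(* [b j] is the number of beads of [la] on runner [j], all of them topmost. *)
Definition flush (p : nat) (b : nat -> nat) (la : seq nat) : Prop :=
  forall n, (n \in beads la) = (n %/ p < b (n %% p)).

(** The positions before [r * p + j] are themselves topmost on each runner, with [r + (l < j)] of
    them on runner [l], so the gaps can be counted runner by runner. *)
Lemma bead_part_runner p b la j r : j < p -> flush p b la ->
  bead_part la (r * p + j) = gaps_before p b j r.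
Proof.
move=> jp fl; have p0 : 0 < p by lia.
have /permP/(_ (fun m => m \notin beads la)) : perm_eq (iota 0 (r * p + j))
    (runner_positions p (fun l => r + (l < j))).
  apply: perm_runner_positions => // [|n]; first exact: iota_uniq.
  rewrite mem_iota /= add0n {1}(divn_eq n p).
  have np := ltn_pmod n p0; case: (ltnP (n %% p) j) => nj.
    rewrite addn1 ltnS; case: (leqP (n %/ p) r) => nr.
      have : n %/ p * p <= r * p by rewrite leq_mul2r nr orbT.
      by lia.
    have : r.+1 * p <= n %/ p * p by rewrite leq_mul2r nr orbT.
    by rewrite mulSn; lia.
  rewrite addn0; case: (ltnP (n %/ p) r) => nr.
    have : (n %/ p).+1 * p <= r * p by rewrite leq_mul2r nr orbT.
    by rewrite mulSn; lia.
  have : r * p <= n %/ p * p by rewrite leq_mul2r nr orbT.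
  by lia.
rewrite /bead_part => ->.
rewrite count_flatten -map_comp sumnE big_map /gaps_before /index_iota subn0.
apply: eq_big_seq => l; rewrite mem_iota /= add0n => lp.
rewrite count_map -count_geq_iota; apply: eq_count => q /=.
by rewrite fl divnMDl // divn_small // addn0 modnMDl modn_small // -leqNgt.
Qed.

Lemma core_p'_gaps p b la : 0 < p -> is_partition la -> flush p b la ->
  p'_parts p la -> forall j r, j < p -> r < b j -> ~~ (p %| gaps_before p b j r).
Proof.
move=> p0 Pla fl /(p'_partsP Pla) p'P j r jp rb.
rewrite -(bead_part_runner r jp fl); apply: p'P.
by rewrite fl divnMDl // divn_small // addn0 modnMDl modn_small.
Qed.

Lemma core_flush p la : 0 < p -> is_partition la -> p_core p la ->
  exists2 b, b 0 = 0 & flush p b la.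
Proof.
move=> p0 Pla /(p_coreP Pla p0) core.
(* [N] exceeds every bead position and hence every row index, so [b j] counts all beads on runner
   j. *)
pose N := (\max_(n <- beads la) n).+1.
have bN n : n \in beads la -> n < N by move=> nb; rewrite ltnS; apply: leq_bigmax_seq.
pose b j := count (fun r => r * p + j \in beads la) (iota 0 N).
have down j r r' : r' <= r -> r * p + j \in beads la -> r' * p + j \in beads la.
  move=> /subnK <-; elim: (r - r') => [//|q IHq].
  rewrite addSn mulSn -addnA => /core; rewrite leq_addr => /(_ isT).
  by rewrite addKn.
have bE j r : (r * p + j \in beads la) = (r < b j).
  apply/idP/idP => [rb|].
    have rN : r < N.
      by have := bN _ rb; have : r <= r * p by [rewrite leq_pmulr]; lia.
    rewrite -[leqLHS](@count_ltn_iota N) //; apply: sub_count => q /= qr.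
    by apply: down rb.
  apply: contraTT => nrb; rewrite -leqNgt.
  apply: leq_trans (_ : count (fun q => q < r) (iota 0 N) <= r); last first.
    case: (leqP r N) => rN; first by rewrite count_ltn_iota.
    by apply: leq_trans (count_size _ _) _; rewrite size_iota ltnW.
  apply: sub_count => q /= qb; rewrite ltnNge; apply: contra nrb => rq.
  by apply: down qb.
exists b => [|n]; last by rewrite -bE -divn_eq.
have := bE 0 0; rewrite addn0 mul0n (negbTE (zero_notin_beads Pla)); lia.
Qed.

Lemma sum_ord_nat n : 2 * \sum_(r <- iota 0 n) r = n * n.-1.
Proof.
have := sum_id n; rewrite -sum_PoszE /index_iota subn0.
set S := bigop.body _ _ _; case: n S => [|n] S; nia.
Qed.

(** The bead positions are summed runner by runner, and the staircase sum from [sumn_beads] is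
    subtracted. *)
Lemma sumn_flush p b la : 0 < p -> is_partition la -> flush p b la ->
  ((2 * sumn la)%N%:Z = core_size2 p id (fun l => (b l)%:Z))%R.
Proof.
move=> p0 Pla fl.
have pb := perm_runner_positions p0 (beads_uniq Pla) fl.
have szE : size la = \sum_(0 <= j < p) b j.
  rewrite -size_beads (perm_size pb) size_allpairs_dep sumnE big_map /index_iota subn0.
  by apply: eq_bigr => j _; rewrite size_iota.
have : 2 * \sum_(n <- beads la) n = \sum_(0 <= j < p) (b j * (b j).-1 * p + 2 * (b j * j)).
  rewrite (perm_big _ pb) big_allpairs_dep big_distrr /= /index_iota subn0.
  apply: eq_bigr => j _; rewrite big_split /= -big_distrl /= mulnDr mulnA sum_ord_nat.
  by rewrite big_const_seq count_predT size_iota iter_addn_0 [j * _]mulnC.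
rewrite sumn_beads // => /(congr1 Posz).
rewrite PoszD sum_PoszE.
have -> : (\sum_(0 <= j < p) (b j * (b j).-1 * p + 2 * (b j * j))%N%:Z =
   p%:Z * \sum_(0 <= l < p) (b l)%:Z ^+ 2 - p%:Z * \sum_(0 <= l < p) (b l)%:Z
   + 2 * \sum_(0 <= l < p) l%:Z * (b l)%:Z)%R.
  rewrite !mulr_sumr -sumrB -big_split; apply: eq_bigr => l _ /=.
  rewrite PoszD !PoszM; case: (b l) => [|m] /=; first by ring.
  have -> : (m.+1%:Z = m%:Z + 1)%R by lia.
  ring.
rewrite /core_size2 -sum_PoszE -szE.
have -> : ((size la * (size la).-1)%N%:Z = (size la)%:Z ^+ 2 - (size la)%:Z)%R.
  rewrite PoszM; case: (size la) => [|m] /=; first by ring.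
  have -> : (m.+1%:Z = m%:Z + 1)%R by lia.
  ring.
lia.
Qed.

(** The positions in decreasing order minus the staircase are the parts. As [b 0 = 0] keeps position
    0 free, these differences are positive. *)
Lemma flush_exists p b : 0 < p -> b 0 = 0 ->
  exists2 la, is_partition la & flush p b la.
Proof.
move=> p0 b0; pose s := sort geq (runner_positions p b).
have Us : uniq s by rewrite sort_uniq runner_positions_uniq.
have memS n : (n \in s) = (n %/ p < b (n %% p)) by rewrite mem_sort mem_runner_positions.
have ss : sorted geq s by apply: sort_sorted => x y; apply: leq_total.
have trg : transitive geq by move=> u v w uv vw; apply: leq_trans vw uv.
have s_lt i j : i < j -> j < size s -> nth 0 s j < nth 0 s i.
  move=> ij js; rewrite ltn_neqAle nth_uniq ?(ltn_trans ij js) //.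
  rewrite gtn_eqF //=; apply: (sorted_ltn_nth trg 0 ss i j) => //.
  by rewrite inE; apply: ltn_trans js.
have s_gt0 k : k < size s -> 0 < nth 0 s k.
  move=> ks; rewrite lt0n; apply/eqP => s0.
  by have := memS 0; rewrite -{1}s0 mem_nth // div0n mod0n b0.
have s_ge d : forall k, k + d = (size s).-1 -> k < size s -> d < nth 0 s k.
  elim: d => [|d IHd] k kd ks; first exact: s_gt0.
  have k1s : k.+1 < size s by lia.
  by apply: leq_ltn_trans (IHd k.+1 _ k1s) (s_lt k k.+1 _ _) => //; lia.
pose la := mkseq (fun k => nth 0 s k - (size s - k.+1)) (size s).
have szla : size la = size s by rewrite size_mkseq.
have nthla k : k < size s -> nth 0 la k = nth 0 s k - (size s - k.+1).
  by move=> ks; rewrite nth_mkseq.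
have s_ge' k : k < size s -> size s - k.+1 < nth 0 s k by move=> ks; apply: s_ge => //; lia.
exists la.
  apply/andP; split.
    apply/(sortedP 0) => k; rewrite szla => ks; rewrite /= !nthla //; last by lia.
    have := s_lt k k.+1 (ltnSn k) ks; have := s_ge' _ ks; lia.
  apply/negP => /(nthP 0)[k]; rewrite szla => ks; rewrite nthla //.
  have := s_ge' k ks; lia.
suff bs : beads la = s by move=> n; rewrite bs.
apply: (@eq_from_nth _ 0); rewrite size_beads // szla => k ks.
rewrite nth_beads ?szla // /bead nthla // szla; have := s_ge' k ks; lia.
Qed.

Lemma flush_p_core p b la : 0 < p -> is_partition la -> flush p b la -> p_core p la.
Proof.
move=> p0 Pla fl; apply/(p_coreP Pla p0) => n + pn.
rewrite !fl -{1 2}(subnK pn) divnDr // divnn p0 modnDr; lia.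
Qed.

Lemma flush_p'_parts p b la : 0 < p -> is_partition la -> flush p b la ->
  (forall j r, j < p -> r < b j -> ~~ (p %| gaps_before p b j r)) -> p'_parts p la.
Proof.
move=> p0 Pla fl valid; apply/(p'_partsP Pla) => n; rewrite fl => nb.
have np := ltn_pmod n p0.
by rewrite (divn_eq n p) (bead_part_runner _ np fl) valid.
Qed.

(** * Cores with sorted runners and their walks *)

Section RightmostCore.
Variables (p : nat) (b : nat -> nat) (la : seq nat).
Hypotheses (p_gt1 : 1 < p) (b_le : forall i, 0 < i < p -> b i.-1 <= b i)
  (fl : flush p b la).

Let p_gt0 : 0 < p. Proof. exact: ltnW. Qed.

Lemma rowP r n : reflect (exists2 j, j < p & n = r * p + j) (n \in Defs.row p r).
Proof.
rewrite /Defs.row mem_iota; apply: (iffP andP) => [[rn nr]|[j jp ->]]; last by lia.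
by exists (n - r * p); lia.
Qed.

Lemma mem_beads_row r j : j < p -> (r * p + j \in beads la) = (r < b j).
Proof. by move=> jp; rewrite fl divnMDl // divn_small // addn0 modnMDl modn_small. Qed.

Lemma flush_rightmost : beads_rightmost p la.
Proof.
move=> r m n /rowP[j jp ->] /rowP[k kp ->]; rewrite ltn_add2l => jk.
rewrite !mem_beads_row // => /leq_trans; apply.
exact: (leq_mono_nat b_le (ltnW jk)).
Qed.

Lemma row_gaps_flush r : row_gaps p la r = count (fun l => b l <= r) (iota 0 p).
Proof.
rewrite /row_gaps /Defs.row -[r * p]addn0 iotaDl count_map; apply: eq_in_count => j.
by rewrite mem_iota => /andP[_ jp]; rewrite /= mem_beads_row // -leqNgt.
Qed.

(** The last bead is on runner [p.-1]. Positivity rules out the empty partition, whose [row_bound]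
    is 1. *)
Lemma row_bound_flush : 0 < b p.-1 -> row_bound p la = b p.-1.
Proof.
move=> bp; rewrite /row_bound.
have p1p : p.-1 < p by lia.
set M := \max_(n <- beads la) n.
have lo : (b p.-1).-1 * p + p.-1 <= M.
  by apply: leq_bigmax_seq; rewrite ?mem_beads_row //; lia.
have hi : M < b p.-1 * p.
  have -> : b p.-1 * p = (b p.-1 * p).-1.+1 by rewrite prednK // muln_gt0 bp.
  rewrite ltnS; apply/bigmax_leqP_seq => n; rewrite fl => nb _.
  have np := ltn_pmod n p_gt0.
  have : n %/ p < b p.-1 by apply: leq_trans nb (leq_mono_nat b_le _ _); lia.
  rewrite ltn_divLR //; lia.
apply/eqP; rewrite eqn_leq ltn_divLR // hi /=.
have := leq_div2r p lo; rewrite divnMDl // divn_small //; lia.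
Qed.

Lemma residue_seq_flush : 0 < b p.-1 ->
  residue_seq p la = [seq (\sum_(0 <= l < p) (r.+1 - b l))%N%:R%R | r <- iota 0 (b p.-1)].
Proof.
move=> bp; have p1p : p.-1 < p by lia.
have row_neq0 r : r < b p.-1 -> row_beads p la r != [::].
  move=> rb; have : r * p + p.-1 \in row_beads p la r.
    by rewrite mem_filter mem_beads_row // rb; apply/rowP; exists p.-1.
  by case: (row_beads p la r).
rewrite /residue_seq row_bound_flush //.
have -> : [seq r <- iota 0 (b p.-1) | row_beads p la r != [::]] = iota 0 (b p.-1).
  by apply/all_filterP/allP => r; rewrite mem_iota => /andP[_ /row_neq0].
apply/eq_in_map => r; rewrite mem_iota => /andP[_ /row_neq0 rn0].
have : head 0 (row_beads p la r) \in row_beads p la r.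
  by case: (row_beads p la r) rn0 => //= x s _; rewrite mem_head.
rewrite mem_filter => /andP[+ /rowP[j jp hE]]; rewrite hE mem_beads_row // => rb.
by rewrite (bead_part_runner _ jp fl) (gaps_before_row_end b_le).
Qed.

End RightmostCore.

Lemma walk_of_corresponds (p : nat) (b : nat -> nat) (la : seq nat) :
  1 < p -> b 0 = 0 -> 0 < b p.-1 ->
  (forall i, 0 < i < p -> b i.-1 <= b i) ->
  (forall j r, j < p -> r < b j -> ~~ (p %| gaps_before p b j r)) ->
  is_partition la -> flush p b la -> corresponds p la (walk_of p b).
Proof.
move=> p1 b0 bp ble valid Pla fl; have p0 : 0 < p := ltnW p1.
have wP : is_walk p (walk_of p b).
  by apply: is_walk_of => // r rb; apply: valid => //; lia.
split=> //.
- by apply/and3P; split; [|exact: flush_p_core fl|exact: flush_p'_parts fl valid].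
- exact: (flush_rightmost p1 ble fl).
- have /and3P[/(pathP (0, 0%R)) wpath wsort _] := wP.
  (* A sorted sequence is determined by its multiplicities, and the labels are the gap counts of the
     rows. *)
  rewrite [LHS](@sorted_flatten_nseq _ p.-1) //; last first.
    move=> x /(nthP 0)[r]; rewrite size_map => rw <-.
    by have /andP[+ _] := wpath r rw; rewrite (nth_map (0, 0%R)) //; lia.
  congr flatten; apply: eq_map => i; congr nseq.
  rewrite /row_mult (row_bound_flush p1 ble fl) // /walk_labels -map_comp count_map.
  by apply: eq_count => r /=; rewrite (row_gaps_flush p1 fl).
- by rewrite (residue_seq_flush p1 ble fl) // /walk_vertices -map_comp.
Qed.

(** * The extremal core and the extremal walk *)

Theorem theorem4p8 (p : nat) (p_prime : prime p) (p_odd : odd p) :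
  exists (la : seq nat) (w : seq (nat * 'Z_p)),
    [/\ unique (is_maximal (core_p'_partition p) sumn) la,
        unique (is_maximal (is_walk p) size) w
      & corresponds p la w].
Proof.
have p1 := prime_gt1 p_prime; have p0 : 0 < p := ltnW p1.
have p2 : 2 < p.
  by rewrite ltn_neqAle p1 andbT; apply: contraTneq p_odd => <-.
have [D [K opt]] := optimal_exists p2.
pose bs := optimal_rows D K.
have bs0 : bs 0 = 0 := optimal_rows0 D K.
have ble := optimal_rows_le p_prime p2 opt; rewrite -/bs in ble.
have valid j r := @optimal_rows_valid p D K p_prime p2 opt j r.
have bp : 0 < bs p.-1.
  have p1p : 0 < p.-1 < p by lia.
  by have := optimal_rows_ge p_prime p2 opt p1p; rewrite -/bs; lia.
have [la Pla fl] := flush_exists p0 bs0.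
have corr := walk_of_corresponds p1 bs0 bp ble valid Pla fl.
have [laP _ wP _ _] := corr.
exists la, (walk_of p bs); split=> //.
(* Every competing core is given by its bead counts, so the comparison of quadratic forms yields
   both maximality and uniqueness. *)
- have dom mu : core_p'_partition p mu -> sumn mu <= sumn la /\ (sumn mu = sumn la -> la = mu).
    case/and3P=> Pmu core parts.
    have [b b0 flb] := core_flush p0 Pmu core.
    have := core_domination p_prime p2 opt b0 (core_p'_gaps p0 Pmu flb parts).
    rewrite /= -(sumn_flush p0 Pmu flb) -(sumn_flush p0 Pla fl) => -[le_size eq_size].
    split=> [|eqs]; first by lia.
    apply: eq_partition => // n; rewrite fl flb eq_size ?ltn_pmod //.
    by rewrite eqs.
  split; first by split=> // mu /dom[].
  move=> mu [/dom[le_mu eq_mu] /(_ la laP) ge_mu].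
  by apply: eq_mu; lia.
- have szw : size (walk_of p bs) = bs p.-1 by rewrite size_mkseq.
  have dom v : is_walk p v ->
      size v <= bs p.-1 /\ (size v = bs p.-1 -> walk_of p bs = v).
    move=> /(walkE p1)[c [c0 cle cvalid csz ->]].
    have [le_c eq_c] := walk_domination p_prime p2 opt c0 cle cvalid.
    rewrite size_mkseq; split=> // /eq_c cE; rewrite /walk_of cE; last by lia.
    apply: eq_map => r; congr (_, _).
      by apply: eq_in_count => l; rewrite mem_iota => /andP[_ lp]; rewrite cE.
    by congr (_%:R)%R; apply: eq_big_nat => l /andP[_ lp]; rewrite cE.
  split; first by split=> // v /dom[]; rewrite szw.
  move=> v [/dom[le_v eq_v] /(_ _ wP)]; rewrite szw => ge_v.
  by apply: eq_v; lia.
Qed.
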